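(* Under the standing setting, if $f_0=f_\infty=0$, then there exist $\lambda_*\in(0,\infty)$ and $m_*\in(0,\infty)$ such that: for every $\lambda\in(\lambda_*,\infty)$ problem (P$_\lambda$) has two positive solutions $u_1(\lambda),u_2(\lambda)$ with $0<\|u_1(\lambda)\|_\infty<m_*<\|u_2(\lambda)\|_\infty$, which can be chosen so that $\lim_{\lambda\to\infty}\|u_1(\lambda)\|_\infty=0$ and $\lim_{\lambda\to\infty}\|u_2(\lambda)\|_\infty=\infty$; and problem (P$_{\lambda_*}$) has a positive solution.
   Context: Standing setting. $\varphi:\mathbb{R}\to\mathbb{R}$ is an odd, increasing homeomorphism satisfying condition (A): there exist increasing homeomorphisms $\psi_1,\psi_2:[0,\infty)\to[0,\infty)$ such that $\varphi(x)\psi_1(y)\le \varphi(xy)\le \varphi(x)\psi_2(y)$ for all $x,y\ge 0$. Let $c,d\in C([0,1],(0,\infty))$, and $\|\cdot\|_\infty$ the maximum norm on $C[0,1]$. Let $f\in C([0,\infty),[0,\infty))$ with $f(s)>0$ for $s>0$, and write $f_0=\lim_{s\to0^+}f(s)/\varphi(s)$, $f_\infty=\lim_{s\to\infty}f(s)/\varphi(s)$ (assumed to exist in $[0,\infty]$ whenever referred to). Let $h\in C((0,1),[0,\infty))$, $h\not\equiv 0$, with $\int_0^{1/2}\psi_1^{-1}\big(\int_s^{1/2}h(\tau)d\tau\big)ds+\int_{1/2}^1\psi_1^{-1}\big(\int_{1/2}^s h(\tau)d\tau\big)ds<\infty$. Notation attached to $h$: $\alpha_h=\sup\{x\in(0,1):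 h=0 \text{ on }(0,x)\}$ ($0$ if empty); $\beta_h=\inf\{x\in(0,1): h=0\text{ on }(x,1)\}$ ($1$ if empty); $\bar\alpha_h=\sup\{x\in(\alpha_h,1]: h>0 \text{ on }(\alpha_h,x)\}$; $\bar\beta_h=\inf\{x\in[0,\beta_h): h>0\text{ on }(x,\beta_h)\}$; $\gamma_h^1=(3\alpha_h+\bar\alpha_h)/4$, $\gamma_h^2=(\bar\beta_h+3\beta_h)/4$. It is assumed that $0\le\alpha_h<\gamma_h^1<\gamma_h^2<\beta_h\le 1$. For $\lambda\ge0$, problem (P$_\lambda$) is: $(d(t)\varphi(c(t)u'(t)))'+\lambda h(t)f(u(t))=0$ for $t\in(0,1)$, $u(0)=u(1)=0$. A solution is $u\in C[0,1]\cap C^1(0,1)$ such that $t\mapsto d(t)\varphi(c(t)u'(t))$ is continuously differentiable on $(0,1)$ and the equation and boundary conditions hold; it is positive if $u(t)>0$ for all $t\in(0,1)$. *)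

(* Defs.v *)
From Stdlib Require Import Reals.
Open Scope R_scope.

Definition cont_on (D : R -> Prop) (g : R -> R) : Prop :=
  forall x, D x -> forall eps, 0 < eps -> exists delta, 0 < delta /\
    forall y, D y -> Rabs (y - x) < delta -> Rabs (g y - g x) < eps.

Definition nonneg_half_line (x : R) : Prop := 0 <= x.
Definition unit_closed (x : R) : Prop := 0 <= x <= 1.
Definition unit_open (x : R) : Prop := 0 < x < 1.

(* odd increasing homeomorphism of R (a continuous strictly increasing
   surjection; its inverse is then automatically continuous) *)
Definition odd_incr_homeo (phi : R -> R) : Prop :=
  continuity phi /\
  (forall x y, x < y -> phi x < phi y) /\
  (forall y, exists x, phi x = y) /\
  (forall x, phi (- x) = - phi x).

Definition incr_homeo_nonneg (psi : R -> R) : Prop :=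
  cont_on nonneg_half_line psi /\
  (forall x y, 0 <= x -> x < y -> psi x < psi y) /\
  (forall x, 0 <= x -> 0 <= psi x) /\
  (forall y, 0 <= y -> exists x, 0 <= x /\ psi x = y).

Definition condA (phi psi1 psi2 : R -> R) : Prop :=
  forall x y, 0 <= x -> 0 <= y ->
    phi x * psi1 y <= phi (x * y) /\ phi (x * y) <= phi x * psi2 y.

Definition RInt_is (g : R -> R) (a b I : R) : Prop :=
  exists pr : Riemann_integrable g a b, RiemannInt pr = I.

(* The integrability condition on h:
   int_0^{1/2} psi1^{-1}(int_s^{1/2} h) ds + int_{1/2}^1 psi1^{-1}(int_{1/2}^s h) ds < oo,
   as improper Riemann integrals of nonnegative continuous integrands
   (finite iff the truncated integrals are bounded).  K1, K2 are the
   integrands; K s = psi1^{-1}(y) is characterised by K s >= 0, psi1 (K s) = y. *)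
Definition h_integrability (psi1 h : R -> R) : Prop :=
  exists K1 K2 : R -> R,
    (forall s, 0 < s <= 1/2 -> exists I, RInt_is h s (1/2) I /\
        0 <= K1 s /\ psi1 (K1 s) = I) /\
    (forall s, 1/2 <= s < 1 -> exists I, RInt_is h (1/2) s I /\
        0 <= K2 s /\ psi1 (K2 s) = I) /\
    (exists M, forall e, 0 < e <= 1/2 -> exists I1 I2,
        RInt_is K1 e (1/2) I1 /\ RInt_is K2 (1/2) (1 - e) I2 /\ I1 + I2 <= M).

Definition is_glb (E : R -> Prop) (m : R) : Prop :=
  (forall x, E x -> m <= x) /\ (forall b, (forall x, E x -> b <= x) -> b <= m).

Definition alpha_set (h : R -> R) (x : R) : Prop :=
  0 < x < 1 /\ forall t, 0 < t < x -> h t = 0.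
Definition is_alpha_h (h : R -> R) (a : R) : Prop :=
  ((exists x, alpha_set h x) /\ is_lub (alpha_set h) a) \/
  ((~ exists x, alpha_set h x) /\ a = 0).

Definition beta_set (h : R -> R) (x : R) : Prop :=
  0 < x < 1 /\ forall t, x < t < 1 -> h t = 0.
Definition is_beta_h (h : R -> R) (b : R) : Prop :=
  ((exists x, beta_set h x) /\ is_glb (beta_set h) b) \/
  ((~ exists x, beta_set h x) /\ b = 1).

Definition is_alphabar_h (h : R -> R) (a abar : R) : Prop :=
  is_lub (fun x => a < x <= 1 /\ forall t, a < t < x -> 0 < h t) abar.

Definition is_betabar_h (h : R -> R) (b bbar : R) : Prop :=
  is_glb (fun x => 0 <= x < b /\ forall t, x < t < b -> 0 < h t) bbar.

Definition is_solution (phi c d h f : R -> R) (lam : R) (u : R -> R) : Prop :=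
  cont_on unit_closed u /\
  exists u' w' : R -> R,
    (forall t, 0 < t < 1 ->
       derivable_pt_lim u t (u' t) /\ continuity_pt u' t /\
       derivable_pt_lim (fun s => d s * phi (c s * u' s)) t (w' t) /\
       continuity_pt w' t /\
       w' t + lam * h t * f (u t) = 0) /\
    u 0 = 0 /\ u 1 = 0.

Definition is_positive_solution (phi c d h f : R -> R) (lam : R) (u : R -> R) : Prop :=
  is_solution phi c d h f lam u /\ forall t, 0 < t < 1 -> 0 < u t.

Definition sup_norm_is (u : R -> R) (m : R) : Prop :=
  is_lub (fun y => exists t, 0 <= t <= 1 /\ y = Rabs (u t)) m.

(* Main.v *)
(* Proof by shooting.  Take [u(0) = 0] and initial flux [p = d phi(c u')(0)] as the
   parameter, discretise the equation with a staggered Euler scheme (so that the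
   landing value [u_N(p)] is continuous in [p] although initial value problems
   need not be uniquely solvable), and let [M(p)] be the maximum of the run.
   Since f/phi tends to 0 at 0 and at infinity, a run with [u_N <= 0] has
   [m0 <= M <= m1]; hence [u_N > 0] for small and for large [p].  A cone estimate
   shows that, for given [m] and all large lambda, [u_N < 0] whenever [M(p) = m].
   The intermediate value theorem therefore yields zeros of [u_N] with [M <= m]
   and others with [M >= m].  All bounds are uniform in the mesh, also near the
   singular end points of [h], and the limit of the discrete solutions along a
   free ultrafilter solves the boundary value problem.  Two different choices of
   [m] separate the two solutions; the limits of the norms hold because [m] is
   arbitrary, once solutions of nearly extremal norm are selected. *)

Require Import Defs.
From Stdlib Require Import Reals ZArith Lra Lia Classical IndefiniteDescription.
From Coquelicot Require Import Coquelicot.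
From mathcomp Require filter.
Open Scope R_scope.

(** * Limits along a free ultrafilter *)

(** The integral of [h] may diverge at both ends, so the flux of a solution can be unbounded there
    and no initial value problem starts at 0. The discretisation avoids this: the shooting parameter
    is the flux at the midpoint of the first cell, and [h] enters only through differences of a
    primitive based at [1/2]. What stays finite is the integral of the slope. The inequality
    [phi x * psi1 y <= phi (x * y)] gives [pinv (phi x * psi1 k) <= x * k]; with [psi1 k] equal to
    an integral of [h] up to [1/2], a flux drop costs a slope linear in [k], and [k] is integrable
    by assumption. The same inequality makes the slopes that belong to the extreme values of [c] and
    [d] comparable, which is the origin of the cone constant [C]. Along an ultrafilter bounded
    sequences converge for all [t] at once; differentiability of the limit is recovered from the
    monotonicity of the fluxes and the interior equicontinuity of the heights. *)

Lemma continuity_pt_eps (F : R -> R) (t : R) : continuity_pt F t -> forall eps, 0 < eps ->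
  exists eta, 0 < eta /\ forall s, Rabs (s - t) < eta -> Rabs (F s - F t) < eps.
Proof.
  intros HF eps He. destruct (HF eps He) as [d [Hd H]]. exists d. split; [exact Hd|].
  intros s Hs. destruct (Req_dec s t) as [->|Hne].
  - now rewrite Rminus_diag, Rabs_R0.
  - apply (H s). repeat split; auto.
Qed.

Lemma continuity_of_eps (F : R -> R) (t : R) :
  (forall eps, 0 < eps -> exists eta, 0 < eta /\
     forall s, Rabs (s - t) < eta -> Rabs (F s - F t) < eps) -> continuity_pt F t.
Proof.
  intros H eps He. destruct (H eps He) as [eta [Heta Hs]]. exists eta. split; [exact Heta|].
  intros s [_ Hd]. now apply Hs.
Qed.

(** Freeness is encoded by [fu_tail]: every tail is large, so eventual facts hold along [U]. *)
Record free_ultrafilter (U : (nat -> Prop) -> Prop) : Prop := {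
  fu_tail : forall n0, U (fun n => (n0 <= n)%nat);
  fu_sub : forall P Q : nat -> Prop, (forall n, P n -> Q n) -> U P -> U Q;
  fu_and : forall P Q : nat -> Prop, U P -> U Q -> U (fun n => P n /\ Q n);
  fu_or : forall P : nat -> Prop, U P \/ U (fun n => ~ P n);
  fu_proper : ~ U (fun _ => False) }.

Lemma free_ultrafilter_exists : exists U, free_ultrafilter U.
Proof.
  (* The filter of cofinite sets; any ultrafilter refining it is free. *)
  set (F := fun P : nat -> Prop => exists n0, forall n, (n0 <= n)%nat -> P n).
  assert (HF : filter.ProperFilter F).
  { constructor.
    - intros [n0 H]. exact (H n0 (le_n _)).
    - constructor.
      + exists O. intros; exact I.
      + intros P Q [n1 H1] [n2 H2]. exists (max n1 n2). intros n Hn.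
        split; [apply H1 | apply H2]; lia.
      + intros P Q HPQ [n1 H1]. exists n1. intros n Hn. apply HPQ, H1, Hn. }
  destruct (filter.ultraFilterLemma HF) as [U [HU HFU]].
  assert (HP : filter.ProperFilter U) by apply HU.
  destruct HP as [Hne [HT HI HS]].
  exists U. constructor.
  - intros n0. apply HFU. exists n0. auto.
  - intros P Q HPQ HUP. exact (HS P Q HPQ HUP).
  - intros P Q HUP HUQ. exact (HI P Q HUP HUQ).
  - intros P. exact (@filter.in_ultra_setVsetC nat U P HU).
  - exact Hne.
Qed.

Section UltraLimit.

Variable U : (nat -> Prop) -> Prop.
Hypothesis HU : free_ultrafilter U.

Definition ulim (x : nat -> R) (l : R) : Prop :=
  forall eps, 0 < eps -> U (fun n => Rabs (x n - l) < eps).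

Lemma fu_all (P : nat -> Prop) : (forall n, P n) -> U P.
Proof.
  intros H. apply (fu_sub U HU (fun n => (0 <= n)%nat)); [auto | apply (fu_tail U HU)].
Qed.

Lemma fu_eventually (P : nat -> Prop) (n0 : nat) :
  (forall n, (n0 <= n)%nat -> P n) -> U P.
Proof. intros H. exact (fu_sub U HU _ _ H (fu_tail U HU n0)). Qed.

Lemma fu_false (P : nat -> Prop) : U P -> (forall n, ~ P n) -> False.
Proof. intros HP H. apply (fu_proper U HU). exact (fu_sub U HU _ _ H HP). Qed.

(** The limit is the supremum of the thresholds that the sequence exceeds on a large set; the
    ultrafilter dichotomy excludes values above [l + eps]. *)
Lemma ulim_exists (x : nat -> R) (B : R) : U (fun n => Rabs (x n) <= B) -> exists l, ulim x l.
Proof.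
  intros HB.
  destruct (completeness (fun a => U (fun n => a <= x n))) as [l [Hl1 Hl2]].
  - exists B. intros a Ha. apply Rnot_lt_le. intros Hlt.
    apply (fu_false _ (fu_and U HU _ _ HB Ha)). intros n [H1 H2].
    apply Rabs_le_between in H1. lra.
  - exists (- B). apply (fu_sub U HU _ _) with (2 := HB). intros n Hn.
    apply Rabs_le_between in Hn. lra.
  - exists l. intros eps Heps.
    assert (H1 : U (fun n => l - eps < x n)).
    { apply NNPP. intros Hn. assert (l <= l - eps); [|lra].
      apply Hl2. intros a Ha. apply Rnot_lt_le. intros Hlt. apply Hn.
      apply (fu_sub U HU _ _) with (2 := Ha). intros n H. lra. }
    assert (H2 : U (fun n => x n < l + eps)).
    { destruct (fu_or U HU (fun n => l + eps <= x n)) as [H|H].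
      - specialize (Hl1 _ H). lra.
      - apply (fu_sub U HU _ _) with (2 := H). intros n Hn. lra. }
    apply (fu_sub U HU _ _) with (2 := fu_and U HU _ _ H1 H2).
    intros n [H3 H4]. apply Rabs_def1; lra.
Qed.

Lemma ulim_le (x y : nat -> R) (a b : R) :
  ulim x a -> ulim y b -> U (fun n => x n <= y n) -> a <= b.
Proof.
  intros Hx Hy H. apply Rnot_lt_le. intros Hlt.
  assert (He : 0 < (a - b) / 2) by lra.
  apply (fu_false _ (fu_and U HU _ _ H (fu_and U HU _ _ (Hx _ He) (Hy _ He)))).
  intros n [H1 [H2 H3]]. apply Rabs_def2 in H2, H3. lra.
Qed.

Lemma ulim_const (a : R) : ulim (fun _ => a) a.
Proof.
  intros eps He. apply fu_all. intros n. rewrite Rminus_diag, Rabs_R0. exact He.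
Qed.

Lemma ulim_le_const (x : nat -> R) (a b : R) :
  ulim x a -> U (fun n => x n <= b) -> a <= b.
Proof. intros Hx H. exact (ulim_le x (fun _ => b) a b Hx (ulim_const b) H). Qed.

Lemma ulim_ge_const (x : nat -> R) (a b : R) :
  ulim x a -> U (fun n => b <= x n) -> b <= a.
Proof. intros Hx H. exact (ulim_le (fun _ => b) x b a (ulim_const b) Hx H). Qed.

Lemma ulim_minus (x y : nat -> R) (a b : R) :
  ulim x a -> ulim y b -> ulim (fun n => x n - y n) (a - b).
Proof.
  intros Hx Hy eps He. assert (H2 : 0 < eps / 2) by lra.
  apply (fu_sub U HU _ _) with (2 := fu_and U HU _ _ (Hx _ H2) (Hy _ H2)).
  intros n [H3 H4]. apply Rabs_def2 in H3, H4. apply Rabs_def1; lra.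
Qed.

Lemma ulim_scal (k : R) (x : nat -> R) (a : R) :
  ulim x a -> ulim (fun n => k * x n) (k * a).
Proof.
  intros Hx eps He.
  assert (Hk : 0 < Rabs k + 1) by (pose proof (Rabs_pos k); lra).
  apply (fu_sub U HU _ _) with (2 := Hx (eps / (Rabs k + 1)) (Rdiv_lt_0_compat _ _ He Hk)).
  intros n Hn. rewrite <- Rmult_minus_distr_l, Rabs_mult.
  apply Rle_lt_trans with (Rabs k * (eps / (Rabs k + 1))).
  - apply Rmult_le_compat_l; [apply Rabs_pos | lra].
  - apply Rlt_le_trans with ((Rabs k + 1) * (eps / (Rabs k + 1))).
    + apply Rmult_lt_compat_r; [apply Rdiv_lt_0_compat; lra | lra].
    + right. field. lra.
Qed.

Lemma ulim_continuity (F : R -> R) (x : nat -> R) (a : R) :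
  continuity_pt F a -> ulim x a -> ulim (fun n => F (x n)) (F a).
Proof.
  intros HF Hx eps He. destruct (continuity_pt_eps F a HF eps He) as [d [Hd H]].
  apply (fu_sub U HU _ _) with (2 := Hx d Hd). intros n Hn. now apply H.
Qed.

End UltraLimit.

(** * The discretised equation *)

(* [u] lives on the nodes [i / N] and the flux [w = d * phi (c * u')] on the cells
   between them; [a i] is the value of a primitive of [h] and [g i] the slope
   [u'] as a function of the flux, both at the midpoint of cell [i].  This
   staggering makes the scheme invariant under time reversal. *)
Definition shooting_scheme (N : nat) (a : nat -> R) (g : nat -> R -> R) (lam : R)
    (fe : R -> R) (u w : nat -> R) : Prop :=
  (forall i, (i < N)%nat -> u (S i) = u i + / INR N * g i (w i)) /\
  (forall i, (S i < N)%nat -> w (S i) = w i - lam * (a (S i) - a i) * fe (u (S i))).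

(** The coefficients [c] and [d] are seen only through two gauges common to all cells, which makes
    the estimates below uniform in the mesh. *)
Definition response (glo ghi : R -> R) (g : R -> R) : Prop :=
  (forall w, g (- w) = - g w) /\ (forall w, 0 <= w -> glo w <= g w <= ghi w).

(** Later [glo w = pinv (w / d1) / c1] and [ghi w = pinv (w / d0) / c0], with [c0], [c1], [d0], [d1]
    bounds of the coefficients; [ghi_glo] is a consequence of condition (A). *)
Record gauges (glo ghi : R -> R) (C : R) : Prop := {
  glo_0 : glo 0 = 0;
  glo_lt : forall x y, x < y -> glo x < glo y;
  ghi_0 : ghi 0 = 0;
  ghi_le : forall x y, x <= y -> ghi x <= ghi y;
  ghi_glo : forall x, 0 <= x -> ghi x <= C * glo x;
  gauge_pos : 0 < C }.

Lemma INR_frac_bound (i N : nat) : (0 < N)%nat -> (i <= N)%nat -> 0 <= INR i / INR N <= 1.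
Proof.
  intros HN Hi. assert (0 < INR N) by (apply lt_0_INR; lia).
  apply le_INR in Hi. pose proof (pos_INR i). split.
  - apply Rdiv_le_0_compat; lra.
  - apply Rmult_le_reg_r with (INR N); [lra|]. unfold Rdiv.
    rewrite Rmult_assoc, Rinv_l; lra.
Qed.

(** * A priori estimates for a single discrete run *)

Section Scheme.

Variables (glo ghi : R -> R) (C : R).
Hypothesis Hgauge : gauges glo ghi C.
Variable N : nat.
Hypothesis HN : (0 < N)%nat.
Variable fe : R -> R.
Hypothesis fe_pos : forall s, 0 <= fe s.
Variable lam : R.
Hypothesis lam_pos : 0 < lam.

Definition admissible (a : nat -> R) (g : nat -> R -> R) : Prop :=
  (forall i, (S i < N)%nat -> a i <= a (S i)) /\
  (forall i, (i < N)%nat -> response glo ghi (g i)).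

(** Reversing time changes the sign of the flux, and the primitive is negated to remain
    nondecreasing. Nodes reflect by [i] to [N - i], cells by [i] to [N - 1 - i]. Every estimate
    proved at the left end thereby holds at the right end. *)
Lemma scheme_reverse (a : nat -> R) (g : nat -> R -> R) (u w : nat -> R) :
  admissible a g -> shooting_scheme N a g lam fe u w ->
  admissible (fun i => - a (N - 1 - i)%nat) (fun i => g (N - 1 - i)%nat) /\
  shooting_scheme N (fun i => - a (N - 1 - i)%nat) (fun i => g (N - 1 - i)%nat) lam fe
    (fun i => u (N - i)%nat) (fun i => - w (N - 1 - i)%nat).
Proof.
  intros [Ha Hg] [Hu Hw]. repeat split.
  - intros i Hi. specialize (Ha (N - 1 - S i)%nat ltac:(lia)).
    replace (S (N - 1 - S i)) with (N - 1 - i)%nat in Ha by lia. lra.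
  - apply Hg. lia.
  - apply Hg; [lia | assumption].
  - apply Hg; [lia | assumption].
  - intros i Hi. destruct (Hg (N - 1 - i)%nat ltac:(lia)) as [Hodd _]. rewrite Hodd.
    specialize (Hu (N - 1 - i)%nat ltac:(lia)).
    replace (S (N - 1 - i)) with (N - i)%nat in Hu by lia.
    replace (N - S i)%nat with (N - 1 - i)%nat by lia. lra.
  - intros i Hi. specialize (Hw (N - 1 - S i)%nat ltac:(lia)).
    replace (S (N - 1 - S i)) with (N - 1 - i)%nat in Hw by lia.
    replace (N - S i)%nat with (N - 1 - i)%nat by lia. lra.
Qed.

Lemma glo_nonneg (x : R) : 0 <= x -> 0 <= glo x.
Proof.
  intros Hx. destruct (Req_dec x 0) as [->|Hne].
  - rewrite (glo_0 _ _ _ Hgauge). lra.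
  - left. rewrite <- (glo_0 _ _ _ Hgauge) at 1. apply (glo_lt _ _ _ Hgauge). lra.
Qed.

Lemma glo_le (x y : R) : x <= y -> glo x <= glo y.
Proof.
  intros [Hlt | ->]; [left; now apply (glo_lt _ _ _ Hgauge) | right; reflexivity].
Qed.

Lemma glo_le_inv (x y : R) : glo x <= glo y -> x <= y.
Proof.
  intros H. apply Rnot_lt_le. intros Hlt. apply (glo_lt _ _ _ Hgauge) in Hlt. lra.
Qed.

Lemma response_neg (g : R -> R) (w : R) : response glo ghi g -> w < 0 -> g w < 0.
Proof.
  intros [Hodd Hb] Hw. destruct (Hb (- w) ltac:(lra)) as [H _].
  rewrite Hodd in H.
  assert (glo 0 < glo (- w)) by (apply (glo_lt _ _ _ Hgauge); lra).
  rewrite (glo_0 _ _ _ Hgauge) in *. lra.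
Qed.

Lemma response_le (g : R -> R) (w x : R) : response glo ghi g -> w <= x -> 0 <= x -> g w <= ghi x.
Proof.
  intros Hg Hw Hx. destruct (Rlt_dec w 0) as [Hneg|Hpos].
  - pose proof (response_neg g w Hg Hneg).
    assert (ghi 0 <= ghi x) by (apply (ghi_le _ _ _ Hgauge); lra).
    rewrite (ghi_0 _ _ _ Hgauge) in *. lra.
  - destruct (proj2 Hg w ltac:(lra)) as [_ H].
    apply Rle_trans with (1 := H), (ghi_le _ _ _ Hgauge), Hw.
Qed.

Lemma response_abs_le (g : R -> R) (w x : R) :
  response glo ghi g -> Rabs w <= x -> Rabs (g w) <= ghi x.
Proof.
  intros Hg Hw. pose proof (Rabs_pos w). apply Rabs_le_between in Hw. apply Rabs_le. split.
  - assert (g (- w) <= ghi x) by (apply response_le; auto; lra).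
    rewrite (proj1 Hg) in H0. lra.
  - apply response_le; auto; lra.
Qed.

Section Run.

Variables (a : nat -> R) (g : nat -> R -> R) (u w : nat -> R).
Hypothesis Hadm : admissible a g.
Hypothesis Hrun : shooting_scheme N a g lam fe u w.

Lemma a_le (i j : nat) : (i <= j < N)%nat -> a i <= a j.
Proof.
  intros [Hij Hj]. induction Hij as [|j Hij IH]; [lra|].
  apply Rle_trans with (a j); [apply IH; lia | apply Hadm, Hj].
Qed.

Lemma flux_drop_ge (i j : nat) (lo : R) : (i <= j < N)%nat ->
  (forall k, (i < k <= j)%nat -> lo <= fe (u k)) ->
  lam * lo * (a j - a i) <= w i - w j.
Proof.
  intros [Hij Hj]. induction Hij as [|j Hij IH]; intros H; [lra|].
  pose proof (IH ltac:(lia) ltac:(intros; apply H; lia)) as H1.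
  rewrite (proj2 Hrun j Hj).
  assert (Ha : 0 <= lam * (a (S j) - a j)).
  { apply Rmult_le_pos; [lra|]. apply (proj1 Hadm) in Hj. lra. }
  pose proof (Rmult_le_compat_l _ _ _ Ha (H (S j) ltac:(lia))). lra.
Qed.

Lemma flux_drop_le (i j : nat) (hi : R) : (i <= j < N)%nat ->
  (forall k, (i < k <= j)%nat -> fe (u k) <= hi) ->
  w i - w j <= lam * hi * (a j - a i).
Proof.
  intros [Hij Hj]. induction Hij as [|j Hij IH]; intros H; [lra|].
  pose proof (IH ltac:(lia) ltac:(intros; apply H; lia)) as H1.
  rewrite (proj2 Hrun j Hj).
  assert (Ha : 0 <= lam * (a (S j) - a j)).
  { apply Rmult_le_pos; [lra|]. apply (proj1 Hadm) in Hj. lra. }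
  pose proof (Rmult_le_compat_l _ _ _ Ha (H (S j) ltac:(lia))). lra.
Qed.

Lemma flux_antitone (i j : nat) : (i <= j < N)%nat -> w j <= w i.
Proof.
  intros [Hij Hj]. induction Hij as [|j Hij IH]; [lra|].
  rewrite (proj2 Hrun j Hj).
  assert (0 <= lam * (a (S j) - a j) * fe (u (S j))).
  { apply Rmult_le_pos; [|apply fe_pos].
    apply Rmult_le_pos; [lra|]. apply (proj1 Hadm) in Hj. lra. }
  specialize (IH ltac:(lia)). lra.
Qed.

Lemma increment_bounds (i j : nat) (lo hi : R) : (i <= j <= N)%nat ->
  (forall k, (i <= k < j)%nat -> lo <= g k (w k) <= hi) ->
  (INR j - INR i) / INR N * lo <= u j - u i <= (INR j - INR i) / INR N * hi.
Proof.
  intros [Hij Hj]. induction Hij as [|j Hij IH]; intros H.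
  - unfold Rdiv. rewrite !Rminus_diag, !Rmult_0_l. lra.
  - destruct IH as [H1 H2]; [lia | intros; apply H; lia |].
    rewrite (proj1 Hrun j ltac:(lia)), S_INR.
    destruct (H j ltac:(lia)) as [H3 H4].
    assert (HN' : 0 < / INR N) by (apply Rinv_0_lt_compat, lt_0_INR; lia).
    pose proof (Rmult_le_compat_l _ _ _ (Rlt_le _ _ HN') H3).
    pose proof (Rmult_le_compat_l _ _ _ (Rlt_le _ _ HN') H4). unfold Rdiv in *.
    replace ((INR j + 1 - INR i) * / INR N) with ((INR j - INR i) * / INR N + / INR N) by ring.
    lra.
Qed.

(** The flux is nonincreasing, so each of the [S i] cells up to [i] has slope at least
    [glo (w i)]. *)
Lemma height_of_flux (i : nat) : (i < N)%nat -> 0 <= w i ->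
  INR (S i) / INR N * glo (w i) <= u (S i) - u O.
Proof.
  intros Hi Hw.
  assert (H : forall j, (j <= i)%nat -> INR (S j) / INR N * glo (w i) <= u (S j) - u O).
  { assert (HN' : 0 < / INR N) by (apply Rinv_0_lt_compat, lt_0_INR; lia).
    assert (Hst : forall j, (j <= i)%nat -> / INR N * glo (w i) <= u (S j) - u j).
    { intros j Hj. rewrite (proj1 Hrun j ltac:(lia)).
      pose proof (flux_antitone j i ltac:(lia)).
      destruct (proj2 (proj2 Hadm j ltac:(lia)) (w j) ltac:(lra)) as [H1 _].
      assert (glo (w i) <= g j (w j)) by (apply Rle_trans with (2 := H1), glo_le; auto).
      assert (/ INR N * glo (w i) <= / INR N * g j (w j)) by (apply Rmult_le_compat_l; lra).
      lra. }
    induction j as [|j IH]; intros Hj.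
    - specialize (Hst O Hj). simpl INR. unfold Rdiv. rewrite Rmult_1_l. lra.
    - specialize (Hst _ Hj). specialize (IH ltac:(lia)).
      rewrite S_INR. unfold Rdiv in *. lra. }
  now apply H.
Qed.

(** A negative flux in the last cell before [k] would make [u] decrease into its maximum; earlier
    fluxes are at least as large. *)
Lemma flux_nonneg_before_max (k : nat) : (k <= N)%nat ->
  (forall i, (i <= N)%nat -> u i <= u k) -> forall i, (i < k)%nat -> 0 <= w i.
Proof.
  intros Hk Hmax i Hi. apply Rle_trans with (w (k - 1)%nat).
  - apply Rnot_lt_le. intros Hneg.
    pose proof (response_neg _ _ (proj2 Hadm (k - 1)%nat ltac:(lia)) Hneg) as Hg.
    pose proof (proj1 Hrun (k - 1)%nat ltac:(lia)) as Hs.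
    replace (S (k - 1)) with k in Hs by lia.
    assert (HN' : 0 < / INR N) by (apply Rinv_0_lt_compat, lt_0_INR; lia).
    pose proof (Hmax (k - 1)%nat ltac:(lia)). nra.
  - apply flux_antitone. lia.
Qed.

Lemma flux_nonpos_at_max (k : nat) : (k < N)%nat ->
  (forall i, (i <= N)%nat -> u i <= u k) -> w k <= 0.
Proof.
  intros Hk Hmax. apply Rnot_lt_le. intros Hpos.
  pose proof (proj1 Hrun k Hk) as Hs.
  destruct (proj2 (proj2 Hadm k Hk) (w k) ltac:(lra)) as [Hg _].
  assert (Hg0 : glo 0 < glo (w k)) by now apply (glo_lt _ _ _ Hgauge).
  rewrite (glo_0 _ _ _ Hgauge) in Hg0.
  assert (HN' : 0 < / INR N) by (apply Rinv_0_lt_compat, lt_0_INR; lia).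
  pose proof (Hmax (S k) ltac:(lia)). nra.
Qed.

(* Before the maximum the slopes decrease up to the factor [C], so [u] cannot
   lie far below the chord from [0] to its maximum. *)
Lemma cone_left (k i : nat) : 0 <= u O -> (i <= k <= N)%nat ->
  (forall j, (j <= N)%nat -> u j <= u k) ->
  INR i / INR N * u k <= (1 + C) * u i.
Proof.
  intros H0 Hik Hmax. pose proof (gauge_pos _ _ _ Hgauge) as HC.
  destruct i as [|i].
  { simpl INR. unfold Rdiv. rewrite !Rmult_0_l. apply Rmult_le_pos; lra. }
  assert (Hw : 0 <= w i) by (apply (flux_nonneg_before_max k); auto; lia).
  pose proof (height_of_flux i ltac:(lia) Hw) as Hh.
  assert (Hg : forall j, (S i <= j < k)%nat -> 0 <= g j (w j) <= C * glo (w i)).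
  { intros j Hj. split.
    - assert (Hj0 : 0 <= w j) by (apply (flux_nonneg_before_max k); auto; lia).
      apply Rle_trans with (glo (w j)); [now apply glo_nonneg |].
      apply (proj2 (proj2 Hadm j ltac:(lia))), Hj0.
    - apply Rle_trans with (ghi (w i)); [|now apply (ghi_glo _ _ _ Hgauge)].
      apply response_le; [apply Hadm; lia | apply flux_antitone; lia | exact Hw]. }
  destruct (increment_bounds (S i) k _ _ ltac:(lia) Hg) as [_ Hinc].
  pose proof (glo_nonneg _ Hw) as Hglo.
  destruct (INR_frac_bound (S i) N HN ltac:(lia)) as [Hb1 Hb2].
  destruct (INR_frac_bound k N HN ltac:(lia)) as [_ Hb3].
  unfold Rdiv in *. rewrite Rmult_minus_distr_r in Hinc.
  set (t := INR (S i) * / INR N) in *. set (s := INR k * / INR N) in *.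
  set (G := glo (w i)) in *.
  (* The time left until [k] is at most 1, so the remaining rise is at most [C * G]. Multiplication
     by [t] then produces [t * G], which [height_of_flux] bounds by [u (S i)]. *)
  assert (Huk : u k <= u (S i) + C * G).
  { assert (0 <= C * G) by (apply Rmult_le_pos; lra). nra. }
  assert (t * u k <= t * u (S i) + C * (t * G)) by nra.
  assert (C * (t * G) <= C * u (S i)) by (apply Rmult_le_compat_l; lra).
  assert (0 <= u (S i)) by nra. nra.
Qed.

(** The midpoint sum of [Kf] telescopes against [E], each cell being compared with the interval
    between its midpoint and the preceding one. The first cell has no predecessor: its midpoint [s]
    is half a mesh width, so it contributes [2 * s * Kf s], and this causes the factor 2. *)
Lemma increments_le_tail (Kf E : R -> R) (C1 Q : R) (k : nat) :
  (forall x y, 0 < x <= y -> y <= 1/2 -> Kf y * (y - x) <= E y - E x) ->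
  (forall x, 0 < x <= 1/2 -> 0 <= E x /\ 0 <= Kf x) ->
  0 <= Q -> (S k <= N)%nat -> (INR k + /2) / INR N <= 1/2 ->
  (forall i, (i <= k)%nat -> g i (w i) <= C1 + Q * Kf ((INR i + /2) / INR N)) ->
  u (S k) - u O <= C1 * (INR (S k) / INR N) + 2 * Q * E ((INR k + /2) / INR N).
Proof.
  intros HE HE0 HQ Hk Hhalf Hg.
  assert (HNR : 0 < INR N) by (apply lt_0_INR; lia).
  assert (HN' : 0 < / INR N) by now apply Rinv_0_lt_compat.
  assert (Hstep : forall i, (i <= k)%nat ->
            u (S i) - u i <= / INR N * C1 + Q * (/ INR N * Kf ((INR i + /2) / INR N))).
  { intros i Hi. rewrite (proj1 Hrun i ltac:(lia)).
    pose proof (Rmult_le_compat_l _ _ _ (Rlt_le _ _ HN') (Hg i Hi)). lra. }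
  assert (Hmid : forall i, (i <= k)%nat -> 0 < (INR i + /2) / INR N <= 1/2).
  { intros i Hi. pose proof (pos_INR i). split.
    - apply Rdiv_lt_0_compat; lra.
    - apply Rle_trans with (2 := Hhalf). apply Rmult_le_compat_r; [lra|].
      apply le_INR in Hi. lra. }
  assert (H : forall i, (i <= k)%nat -> u (S i) - u O <=
            C1 * (INR (S i) / INR N) + 2 * Q * E ((INR i + /2) / INR N)).
  { induction i as [|i IH]; intros Hi.
    - pose proof (Hstep O Hi) as Hs. destruct (Hmid O Hi) as [Hm1 Hm2].
      set (s := (INR 0 + / 2) / INR N) in *.
      assert (Hs2 : / INR N = 2 * s) by (unfold s; simpl INR; field; lra).
      assert (Kf s * s <= E s).
      { apply Rnot_lt_le. intros Hlt.
        destruct (Rle_dec (Kf s) 0) as [Hk0|Hk0].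
        { destruct (HE0 s ltac:(lra)). nra. }
        (* The step inequality is available only for [0 < x]. This [x] is so small that
           [Kf s * (s - x)] still exceeds [E s], which contradicts [0 <= E x]. *)
        set (x := (Kf s * s - E s) / (2 * Kf s)).
        assert (Hx : Kf s * x = (Kf s * s - E s) / 2) by (unfold x; field; lra).
        destruct (HE0 s ltac:(lra)) as [HEs _].
        assert (0 < x <= s).
        { split; apply Rmult_lt_reg_l with (Kf s) || apply Rmult_le_reg_l with (Kf s); nra. }
        pose proof (HE x s ltac:(lra) Hm2). destruct (HE0 x ltac:(lra)). nra. }
      replace (INR 1 / INR N) with (/ INR N) by (simpl INR; field; lra).
      rewrite Hs2 in Hs |- *. nra.
    - specialize (IH ltac:(lia)). pose proof (Hstep (S i) Hi) as Hs.
      destruct (Hmid (S i) Hi) as [Hm1 Hm2]. destruct (Hmid i ltac:(lia)) as [Hm3 _].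
      set (s := (INR i + / 2) / INR N) in *.
      set (s' := (INR (S i) + / 2) / INR N) in *.
      assert (Hss : s' - s = / INR N) by (unfold s, s'; rewrite S_INR; field; lra).
      pose proof (HE s s' ltac:(lra) Hm2) as HEs. rewrite Hss in HEs.
      destruct (HE0 s' ltac:(lra)) as [_ HKs].
      replace (INR (S (S i)) / INR N) with (INR (S i) / INR N + / INR N)
        by (rewrite (S_INR (S i)); field; lra).
      assert (HEs' : Q * (Kf s' * / INR N) <= Q * (E s' - E s)) by (apply Rmult_le_compat_l; lra).
      assert (0 <= Q * (Kf s' * / INR N)) by (apply Rmult_le_pos; [|apply Rmult_le_pos]; lra).
      nra. }
  apply H. lia.
Qed.

End Run.

(** Beyond the maximum, [cone_left] applies to the reversed run. *)
Lemma cone (a : nat -> R) (g : nat -> R -> R) (u w : nat -> R) (k i : nat) (theta : R) :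
  admissible a g -> shooting_scheme N a g lam fe u w ->
  0 <= u O -> 0 <= u N -> (k <= N)%nat -> (forall j, (j <= N)%nat -> u j <= u k) ->
  (i <= N)%nat -> theta <= INR i / INR N -> theta <= INR (N - i) / INR N ->
  theta * u k <= (1 + C) * u i.
Proof.
  intros Hadm Hrun H0 HN0 Hk Hmax Hi Ht1 Ht2.
  pose proof (Hmax O ltac:(lia)).
  destruct (Nat.le_ge_cases i k) as [Hik|Hik].
  - apply Rle_trans with (INR i / INR N * u k); [apply Rmult_le_compat_r; lra|].
    apply (cone_left a g u w Hadm Hrun); auto.
  - destruct (scheme_reverse a g u w Hadm Hrun) as [Hadm' Hrun'].
    pose proof (cone_left _ _ _ _ Hadm' Hrun' (N - k) (N - i)) as Hc. cbv beta in Hc.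
    rewrite Nat.sub_0_r in Hc.
    replace (N - (N - k))%nat with k in Hc by lia.
    replace (N - (N - i))%nat with i in Hc by lia.
    apply Rle_trans with (INR (N - i) / INR N * u k); [apply Rmult_le_compat_r; lra|].
    apply Hc; auto; [lia | intros j Hj; apply Hmax; lia].
Qed.

(** A positive flux has forced a climb since the left end, a negative one forces a descent to the
    right end; [theta] is a lower bound for the time available in either case. *)
Lemma flux_bound (a : nat -> R) (g : nat -> R -> R) (u w : nat -> R) (i : nat) (theta M : R) :
  admissible a g -> shooting_scheme N a g lam fe u w ->
  0 <= u O -> 0 <= u N -> (forall j, (j <= N)%nat -> u j <= M) ->
  (i < N)%nat -> theta <= INR (S i) / INR N -> theta <= INR (N - i) / INR N ->
  theta * glo (Rabs (w i)) <= M.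
Proof.
  intros Hadm Hrun H0 HN0 HM Hi Ht1 Ht2.
  pose proof (glo_nonneg (Rabs (w i)) (Rabs_pos _)) as Hg.
  destruct (Rle_dec 0 (w i)) as [Hw|Hw].
  - rewrite (Rabs_pos_eq _ Hw) in *.
    pose proof (height_of_flux a g u w Hadm Hrun i Hi Hw).
    pose proof (HM (S i) ltac:(lia)).
    apply Rle_trans with (INR (S i) / INR N * glo (w i)); [apply Rmult_le_compat_r|]; lra.
  - rewrite Rabs_left in * by lra.
    destruct (scheme_reverse a g u w Hadm Hrun) as [Hadm' Hrun'].
    pose proof (height_of_flux _ _ _ _ Hadm' Hrun' (N - 1 - i) ltac:(lia)) as Hh.
    cbv beta in Hh. rewrite Nat.sub_0_r in Hh.
    replace (N - 1 - (N - 1 - i))%nat with i in Hh by lia.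
    replace (S (N - 1 - i)) with (N - i)%nat in Hh by lia.
    replace (N - (N - i))%nat with i in Hh by lia.
    specialize (Hh ltac:(lra)). pose proof (HM i ltac:(lia)).
    apply Rle_trans with (INR (N - i) / INR N * glo (- w i)); [apply Rmult_le_compat_r|]; lra.
Qed.

(* By the cone estimate [fe (u j) >= D] on the nodes between the cells [ia] and
   [ib]; the flux drop this forces makes the slope large at [ia] or at [ib]. *)
Lemma height_lower_bound (a : nat -> R) (g : nat -> R -> R) (u w : nat -> R) (k ia ib : nat)
    (theta D : R) :
  admissible a g -> shooting_scheme N a g lam fe u w ->
  0 <= u O -> 0 <= u N -> (k <= N)%nat -> (forall j, (j <= N)%nat -> u j <= u k) ->
  (ia <= ib < N)%nat -> 0 <= theta ->
  theta <= INR (S ia) / INR N -> theta <= INR (N - ib) / INR N ->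
  (forall s, theta * u k <= (1 + C) * s -> s <= u k -> D <= fe s) ->
  theta * glo (lam * D * (a ib - a ia) / 2) <= u k.
Proof.
  intros Hadm Hrun H0 HN0 Hk Hmax Hab Hth Ht1 Ht2 HD.
  assert (HNR : 0 < / INR N) by (apply Rinv_0_lt_compat, lt_0_INR; lia).
  assert (Hfrac : forall p q, (p <= q)%nat -> INR p / INR N <= INR q / INR N).
  { intros p q Hpq. apply Rmult_le_compat_r; [lra|]. now apply le_INR. }
  assert (Hdrop : lam * D * (a ib - a ia) <= w ia - w ib).
  { apply (flux_drop_ge a g u w Hadm Hrun ia ib D Hab). intros j Hj. apply HD.
    - apply (cone a g u w k j theta); auto; [lia | |].
      + apply Rle_trans with (1 := Ht1), Hfrac. lia.
      + apply Rle_trans with (1 := Ht2), Hfrac. lia.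
    - apply Hmax. lia. }
  assert (Hcases : lam * D * (a ib - a ia) / 2 <= Rabs (w ia) \/
                   lam * D * (a ib - a ia) / 2 <= Rabs (w ib)).
  { pose proof (Rle_abs (w ia)). pose proof (Rle_abs (- w ib)). rewrite Rabs_Ropp in *.
    destruct (Rle_dec (lam * D * (a ib - a ia) / 2) (w ia)); [left | right]; lra. }
  destruct Hcases as [Hc|Hc].
  - apply Rle_trans with (theta * glo (Rabs (w ia))).
    + apply Rmult_le_compat_l; [lra | now apply glo_le].
    + apply (flux_bound a g u w); auto; [lia |].
      apply Rle_trans with (1 := Ht2), Hfrac. lia.
  - apply Rle_trans with (theta * glo (Rabs (w ib))).
    + apply Rmult_le_compat_l; [lra | now apply glo_le].
    + apply (flux_bound a g u w); auto; [lia |].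
      apply Rle_trans with (1 := Ht1), Hfrac. lia.
Qed.

(* [Kf] plays the role of [psi1^-1 (int_s^{1/2} h)] and [E] that of its primitive
   vanishing at [0]. *)
Record tail_majorant (Kf E : R -> R) (B : R) : Prop := {
  tail_step : forall x y, 0 < x <= y -> y <= 1/2 -> Kf y * (y - x) <= E y - E x;
  tail_pos : forall x, 0 < x <= 1/2 -> 0 <= E x /\ 0 <= Kf x;
  tail_le : forall x, 0 < x <= 1/2 -> E x <= B }.

Lemma midpoint_range (K i : nat) : N = (2 * K + 1)%nat -> (i <= K)%nat ->
  0 < (INR i + /2) / INR N <= 1/2.
Proof.
  intros HK Hi. assert (HNR : 0 < INR N) by (apply lt_0_INR; lia).
  pose proof (pos_INR i). apply le_INR in Hi. split.
  - apply Rdiv_lt_0_compat; lra.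
  - apply Rmult_le_reg_r with (INR N); [lra|]. unfold Rdiv at 1.
    rewrite Rmult_assoc, Rinv_l, HK, plus_INR, mult_INR by lra. simpl INR. lra.
Qed.

(** The flux in the cell after the maximum is nonpositive, so each earlier flux is at most the drop
    that follows it, hence at most [lam * F * (a K - a i)]. The tail majorant sums the corresponding
    slopes. *)
Lemma height_upper_left (a : nat -> R) (g : nat -> R -> R) (u w : nat -> R) (K k : nat)
    (Kf E : R -> R) (B Q F : R) :
  admissible a g -> shooting_scheme N a g lam fe u w -> tail_majorant Kf E B -> 0 <= Q ->
  N = (2 * K + 1)%nat -> (k <= K)%nat -> (forall j, (j <= N)%nat -> u j <= u k) ->
  (forall j, (j <= N)%nat -> fe (u j) <= F) ->
  (forall i, (i <= K)%nat -> ghi (lam * F * (a K - a i)) <= Q * Kf ((INR i + /2) / INR N)) ->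
  u k - u O <= 2 * Q * B.
Proof.
  intros Hadm Hrun HE HQ HK Hk Hmax HF Hq.
  assert (HB : forall i, (i <= K)%nat -> 0 <= E ((INR i + /2) / INR N) <= B).
  { intros i Hi. pose proof (midpoint_range K i HK Hi). split.
    - now apply (tail_pos _ _ _ HE).
    - now apply (tail_le _ _ _ HE). }
  destruct k as [|k].
  { rewrite Rminus_diag. pose proof (HB O ltac:(lia)). apply Rmult_le_pos; lra. }
  assert (HF0 : 0 <= F) by (apply Rle_trans with (fe (u O)); [apply fe_pos | apply HF; lia]).
  assert (Hg : forall i, (i <= k)%nat -> g i (w i) <= 0 + Q * Kf ((INR i + /2) / INR N)).
  { intros i Hi. rewrite Rplus_0_l. apply Rle_trans with (2 := Hq i ltac:(lia)).
    pose proof (flux_drop_le a g u w Hadm Hrun i (S k) F ltac:(lia)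
      ltac:(intros; apply HF; lia)) as Hd.
    pose proof (flux_nonpos_at_max a g u w Hadm Hrun (S k) ltac:(lia) Hmax) as Hw.
    pose proof (a_le a g Hadm (S k) K ltac:(lia)) as Ha1.
    pose proof (a_le a g Hadm i (S k) ltac:(lia)) as Ha2.
    assert (HlF : 0 <= lam * F) by (apply Rmult_le_pos; lra).
    apply response_le; [apply Hadm; lia | |].
    - apply Rle_trans with (lam * F * (a (S k) - a i)); [lra|].
      apply Rmult_le_compat_l; lra.
    - apply Rmult_le_pos; lra. }
  pose proof (increments_le_tail a g u w Hrun Kf E 0 Q k
    (tail_step _ _ _ HE) (tail_pos _ _ _ HE) HQ ltac:(lia)
    ltac:(apply (midpoint_range K); [exact HK | lia]) Hg) as H.
  destruct (HB k ltac:(lia)) as [_ HBk].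
  assert (2 * Q * E ((INR k + / 2) / INR N) <= 2 * Q * B) by (apply Rmult_le_compat_l; lra).
  lra.
Qed.

(** A modulus of continuity at the left end that does not involve the mesh. The central flux is
    bounded by [P], and moving left adds at most a drop whose slope is dominated by [C1 + Q * Kf],
    although the drop itself may be unbounded near 0. *)
Lemma boundary_layer (a : nat -> R) (g : nat -> R -> R) (u w : nat -> R) (K i : nat)
    (Kf E : R -> R) (B C1 Q P F eta : R) :
  admissible a g -> shooting_scheme N a g lam fe u w -> tail_majorant Kf E B ->
  0 <= C1 -> 0 <= Q -> 0 <= P -> N = (2 * K + 1)%nat -> w K <= P ->
  (forall j, (j <= N)%nat -> fe (u j) <= F) ->
  (forall j, (j <= K)%nat ->
     ghi (P + lam * F * (a K - a j)) <= C1 + Q * Kf ((INR j + /2) / INR N)) ->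
  (i <= N)%nat -> 0 < eta <= 1/2 -> INR i / INR N <= eta ->
  u i - u O <= C1 * eta + 2 * Q * E eta.
Proof.
  intros Hadm Hrun HE HC1 HQ HP HK HwK HF Hg Hi Heta Hie.
  assert (HEeta : 0 <= E eta) by (apply (tail_pos _ _ _ HE); lra).
  assert (H1 : 0 <= C1 * eta) by (apply Rmult_le_pos; lra).
  assert (H2 : 0 <= 2 * Q * E eta) by (apply Rmult_le_pos; lra).
  destruct i as [|i]; [lra|].
  assert (HNR : 0 < INR N) by (apply lt_0_INR; lia).
  assert (HiK : (S i <= K)%nat).
  { apply INR_le. assert (HiN : INR (S i) <= INR N / 2).
    { apply Rmult_le_reg_r with (/ INR N); [now apply Rinv_0_lt_compat|].
      replace (INR N / 2 * / INR N) with (1 / 2) by (field; lra). unfold Rdiv in *. lra. }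
    rewrite HK, plus_INR, mult_INR in HiN. simpl (INR 2) in HiN. simpl (INR 1) in HiN.
    apply Rnot_lt_le. intros Hlt.
    apply INR_lt, le_INR in Hlt. rewrite S_INR in Hlt. lra. }
  assert (HF0 : 0 <= F) by (apply Rle_trans with (fe (u O)); [apply fe_pos | apply HF; lia]).
  assert (HlF : 0 <= lam * F) by (apply Rmult_le_pos; lra).
  assert (Hgw : forall j, (j <= i)%nat -> g j (w j) <= C1 + Q * Kf ((INR j + /2) / INR N)).
  { intros j Hj. apply Rle_trans with (2 := Hg j ltac:(lia)).
    pose proof (flux_drop_le a g u w Hadm Hrun j K F ltac:(lia)
      ltac:(intros; apply HF; lia)) as Hd.
    pose proof (a_le a g Hadm j K ltac:(lia)) as Ha.
    assert (0 <= lam * F * (a K - a j)) by (apply Rmult_le_pos; lra).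
    apply response_le; [apply Hadm; lia | lra | lra]. }
  pose proof (midpoint_range K i HK ltac:(lia)) as Hm.
  pose proof (increments_le_tail a g u w Hrun Kf E C1 Q i
    (tail_step _ _ _ HE) (tail_pos _ _ _ HE) HQ ltac:(lia) (proj2 Hm) Hgw) as H.
  set (s := (INR i + / 2) / INR N) in *.
  assert (Hs : s <= eta).
  { apply Rle_trans with (2 := Hie). unfold s. rewrite S_INR.
    apply Rmult_le_compat_r; [left; now apply Rinv_0_lt_compat | lra]. }
  assert (HEs : E s <= E eta).
  { pose proof (tail_step _ _ _ HE s eta ltac:(lra) ltac:(lra)).
    destruct (tail_pos _ _ _ HE eta ltac:(lra)) as [_ HKe].
    assert (0 <= Kf eta * (eta - s)) by (apply Rmult_le_pos; lra). lra. }
  assert (C1 * (INR (S i) / INR N) <= C1 * eta) by (apply Rmult_le_compat_l; lra).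
  assert (2 * Q * E s <= 2 * Q * E eta) by (apply Rmult_le_compat_l; lra).
  lra.
Qed.

(** The maximum lies in one of the two halves; the right one is reduced to the left one by
    reversal. *)
Lemma height_upper_bound (a : nat -> R) (g : nat -> R -> R) (u w : nat -> R) (K k : nat)
    (KL EL KR ER : R -> R) (B Q F : R) :
  admissible a g -> shooting_scheme N a g lam fe u w ->
  tail_majorant KL EL B -> tail_majorant KR ER B -> 0 <= Q ->
  N = (2 * K + 1)%nat -> u O <= 0 -> u N <= 0 ->
  (k <= N)%nat -> (forall j, (j <= N)%nat -> u j <= u k) ->
  (forall j, (j <= N)%nat -> fe (u j) <= F) ->
  (forall i, (i <= K)%nat -> ghi (lam * F * (a K - a i)) <= Q * KL ((INR i + /2) / INR N)) ->
  (forall i, (i <= K)%nat ->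
     ghi (lam * F * (a (2 * K - i)%nat - a K)) <= Q * KR ((INR i + /2) / INR N)) ->
  u k <= 2 * Q * B.
Proof.
  intros Hadm Hrun HL HR HQ HK H0 HN0 Hk Hmax HF HqL HqR.
  destruct (Nat.le_gt_cases k K) as [HkK|HkK].
  - pose proof (height_upper_left a g u w K k KL EL B Q F). intuition lra.
  - destruct (scheme_reverse a g u w Hadm Hrun) as [Hadm' Hrun'].
    pose proof (height_upper_left _ _ _ _ K (N - k) KR ER B Q F Hadm' Hrun' HR HQ HK
      ltac:(lia)) as H. cbv beta in H.
    rewrite Nat.sub_0_r in H. replace (N - (N - k))%nat with k in H by lia.
    assert (u k - u N <= 2 * Q * B); [|lra].
    apply H.
    + intros j Hj. apply Hmax. lia.
    + intros j Hj. apply HF. lia.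
    + intros i Hi. replace (N - 1 - K)%nat with K by lia.
      replace (N - 1 - i)%nat with (2 * K - i)%nat by lia.
      replace (- a K - - a (2 * K - i)%nat) with (a (2 * K - i)%nat - a K) by ring.
      now apply HqR.
Qed.

End Scheme.

(** * Shooting *)

Lemma continuity_ext (F G : R -> R) : (forall x, F x = G x) -> continuity F -> continuity G.
Proof. intros H HF x. now apply (continuity_pt_ext F). Qed.

Lemma continuity_Rmax (F G : R -> R) :
  continuity F -> continuity G -> continuity (fun x => Rmax (F x) (G x)).
Proof.
  intros HF HG.
  apply (continuity_ext (fun x => / 2 * ((F x + G x) + Rabs (F x - G x)))).
  - intros x. unfold Rmax. destruct (Rle_dec (F x) (G x)).
    + rewrite Rabs_left1; lra.
    + rewrite Rabs_pos_eq; lra.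
  - apply (continuity_scal (fun x => (F x + G x) + Rabs (F x - G x))).
    apply (continuity_plus (fun x => F x + G x) (fun x => Rabs (F x - G x))).
    + exact (continuity_plus _ _ HF HG).
    + exact (continuity_comp (fun x => F x - G x) Rabs (continuity_minus _ _ HF HG)
        Rcontinuity_abs).
Qed.

Lemma continuity_Rmin (F G : R -> R) :
  continuity F -> continuity G -> continuity (fun x => Rmin (F x) (G x)).
Proof.
  intros HF HG. apply (continuity_ext (fun x => - Rmax (- F x) (- G x))).
  - intros x. rewrite <- Ropp_Rmin. ring.
  - apply (continuity_opp (fun x => Rmax (- F x) (- G x))).
    apply continuity_Rmax; now apply continuity_opp.
Qed.

(** The maximum is needed as a value continuous in the shooting parameter; its index may jump. *)
Fixpoint max_upto (u : nat -> R) (n : nat) : R :=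
  match n with O => u O | S n' => Rmax (max_upto u n') (u (S n')) end.

Definition argmax_upto (u : nat -> R) (N k : nat) : Prop :=
  (k <= N)%nat /\ forall i, (i <= N)%nat -> u i <= u k.

Lemma max_upto_attained (u : nat -> R) (N : nat) :
  exists k, argmax_upto u N k /\ max_upto u N = u k.
Proof.
  induction N as [|N [k [[Hk H] IH]]]; simpl.
  - exists O. repeat split; [lia|]. intros i Hi. replace i with O by lia. lra.
  - rewrite IH. destruct (Rle_dec (u (S N)) (u k)) as [Hle|Hgt].
    + exists k. rewrite Rmax_left by lra. repeat split; [lia|]. intros i Hi.
      destruct (Nat.eq_dec i (S N)) as [->|Hne]; [exact Hle | apply H; lia].
    + exists (S N). rewrite Rmax_right by lra. repeat split; [lia|]. intros i Hi.
      destruct (Nat.eq_dec i (S N)) as [->|Hne]; [lra |].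
      specialize (H i ltac:(lia)). lra.
Qed.

Fixpoint shoot (N : nat) (a : nat -> R) (g : nat -> R -> R) (lam : R) (fe : R -> R)
    (p : R) (i : nat) : R * R :=
  match i with
  | O => (0, p)
  | S j =>
      let (u, w) := shoot N a g lam fe p j in
      let u' := u + / INR N * g j w in
      (u', w - lam * (a (S j) - a j) * fe u')
  end.

Section Shooting.

Variables (glo ghi : R -> R) (C : R).
Hypothesis Hgauge : gauges glo ghi C.
Hypothesis glo_unbounded : forall y, exists x, 0 < x /\ y <= glo x.
Variable N : nat.
Hypothesis HN : (0 < N)%nat.
Variable fe : R -> R.
Hypothesis fe_pos : forall s, 0 <= fe s.
Hypothesis fe_0 : fe 0 = 0.
Hypothesis fe_cont : continuity fe.
Variable lam : R.
Hypothesis lam_pos : 0 < lam.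
Variables (a : nat -> R) (g : nat -> R -> R).
Hypothesis Hadm : admissible glo ghi N a g.
Hypothesis g_cont : forall i, (i < N)%nat -> continuity (g i).

Let U (p : R) (i : nat) : R := fst (shoot N a g lam fe p i).
Let W (p : R) (i : nat) : R := snd (shoot N a g lam fe p i).

Lemma shoot_scheme (p : R) : shooting_scheme N a g lam fe (U p) (W p).
Proof.
  unfold U, W. split; intros i Hi; simpl; destruct (shoot N a g lam fe p i); reflexivity.
Qed.

Lemma shoot_continuous (i : nat) : (i <= N)%nat ->
  continuity (fun p => U p i) /\ continuity (fun p => W p i).
Proof.
  induction i as [|i IH]; intros Hi.
  - split; [exact (continuity_const (fct_cte 0) (fun _ _ => eq_refl)) |].
    exact (derivable_continuous _ derivable_id).
  - destruct (IH ltac:(lia)) as [IHu IHw].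
    assert (Hu : continuity (fun p => U p (S i))).
    { apply (continuity_ext (fun p => U p i + / INR N * g i (W p i))).
      - intros p. unfold U, W. simpl. destruct (shoot N a g lam fe p i). reflexivity.
      - apply (continuity_plus (fun p => U p i) (fun p => / INR N * g i (W p i))); [exact IHu|].
        apply (continuity_scal (fun p => g i (W p i))).
        exact (continuity_comp (fun p => W p i) (g i) IHw (g_cont i ltac:(lia))). }
    split; [exact Hu|].
    apply (continuity_ext (fun p => W p i - lam * (a (S i) - a i) * fe (U p (S i)))).
    + intros p. unfold U, W. simpl. destruct (shoot N a g lam fe p i). reflexivity.
    + apply (continuity_minus (fun p => W p i) (fun p => lam * (a (S i) - a i) * fe (U p (S i))));
        [exact IHw|].
      apply (continuity_scal (fun p => fe (U p (S i)))).
      exact (continuity_comp (fun p => U p (S i)) fe Hu fe_cont).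
Qed.

Let height (p : R) : R := max_upto (U p) N.

Lemma height_continuous : continuity height.
Proof.
  unfold height.
  assert (H : forall n, (n <= N)%nat -> continuity (fun p => max_upto (U p) n)).
  { induction n as [|n IH]; intros Hn; simpl.
    - now apply shoot_continuous.
    - apply continuity_Rmax; [apply IH; lia | now apply shoot_continuous]. }
  now apply H.
Qed.

(** The first node alone reaches this height. The dependence on [N] is harmless, since the bound
    only provides positivity and unboundedness for a fixed mesh. *)
Lemma height_ge (p : R) : 0 <= p -> / INR N * glo p <= height p.
Proof.
  intros Hp. destruct (max_upto_attained (U p) N) as [k [[_ Hmax] Hk]].
  unfold height. rewrite Hk. apply Rle_trans with (U p 1%nat); [|apply Hmax; lia].
  rewrite (proj1 (shoot_scheme p) O HN).
  replace (U p O) with 0 by reflexivity. replace (W p O) with p by reflexivity.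
  rewrite Rplus_0_l. apply Rmult_le_compat_l.
  - left. apply Rinv_0_lt_compat, lt_0_INR. lia.
  - apply (proj2 (proj2 Hadm O HN)), Hp.
Qed.

Lemma height_unbounded (y : R) : exists p, 0 < p /\ y <= height p.
Proof.
  assert (HNR : 0 < INR N) by (apply lt_0_INR; lia).
  destruct (glo_unbounded (INR N * y)) as [p [Hp Hy]]. exists p. split; [exact Hp|].
  apply Rle_trans with (2 := height_ge p (Rlt_le _ _ Hp)).
  apply Rmult_le_reg_l with (INR N); [exact HNR|].
  rewrite <- Rmult_assoc, Rinv_r; lra.
Qed.

Lemma shoot_0 (i : nat) : (i <= N)%nat -> U 0 i = 0 /\ W 0 i = 0.
Proof.
  induction i as [|i IH]; intros Hi; [split; reflexivity|].
  destruct (IH ltac:(lia)) as [IHu IHw]. unfold U, W in *. simpl.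
  destruct (shoot N a g lam fe 0 i) as [u w]. simpl in *. subst.
  assert (Hg : g i 0 = 0).
  { destruct (proj2 Hadm i ltac:(lia)) as [Hodd _]. specialize (Hodd 0).
    rewrite Ropp_0 in Hodd. lra. }
  rewrite Hg, Rmult_0_r, Rplus_0_l, fe_0. split; ring.
Qed.

Lemma height_0 : height 0 = 0.
Proof.
  unfold height. destruct (max_upto_attained (U 0) N) as [k [[Hk _] ->]].
  now apply shoot_0.
Qed.

Definition discrete_solution (u w : nat -> R) (k : nat) : Prop :=
  shooting_scheme N a g lam fe u w /\ u O = 0 /\ u N = 0 /\ argmax_upto u N k.

Variables (m m0 m1 : R).
Hypothesis Hm : 0 < m.
Hypothesis Hm0 : 0 < m0.
(** These two hypotheses are supplied by [landing_bounds] and, for large [lam] and fine meshes, by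
    [height_avoided]. *)
Hypothesis landing_height : forall u w k, shooting_scheme N a g lam fe u w ->
  u O = 0 -> u N <= 0 -> argmax_upto u N k -> 0 < u k -> m0 <= u k <= m1.
Hypothesis no_landing_at_m : forall u w k, shooting_scheme N a g lam fe u w ->
  u O = 0 -> 0 <= u N -> argmax_upto u N k -> u k <> m.

Lemma height_pos (p : R) : 0 < p -> 0 < height p.
Proof.
  intros Hp. apply Rlt_le_trans with (2 := height_ge p (Rlt_le _ _ Hp)).
  apply Rmult_lt_0_compat.
  - apply Rinv_0_lt_compat, lt_0_INR. lia.
  - rewrite <- (glo_0 _ _ _ Hgauge) at 1. now apply (glo_lt _ _ _ Hgauge).
Qed.

Lemma shoot_landing_height (p : R) : U p N <= 0 -> 0 < height p -> m0 <= height p <= m1.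
Proof.
  intros HpN Hh. unfold height in *.
  destruct (max_upto_attained (U p) N) as [k [Hk Hhk]]. rewrite Hhk in *.
  exact (landing_height (U p) (W p) k (shoot_scheme p) eq_refl HpN Hk Hh).
Qed.

Lemma shoot_height_ne (p : R) : 0 <= U p N -> height p <> m.
Proof.
  intros HpN. unfold height.
  destruct (max_upto_attained (U p) N) as [k [Hk ->]].
  exact (no_landing_at_m (U p) (W p) k (shoot_scheme p) eq_refl HpN Hk).
Qed.

Lemma continuity_landing : continuity (fun p => U p N).
Proof. now apply shoot_continuous. Qed.

Lemma continuity_cst (y : R) : continuity (fun _ => y).
Proof. exact (continuity_const (fct_cte y) (fun _ _ => eq_refl)). Qed.

(* A zero of [min (u_N, m - height)] is a zero of [u_N], since [u_N < 0]
   whenever the height is [m]. *)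
Lemma low_discrete_solution : exists u w k, discrete_solution u w k /\ m0 <= u k <= m.
Proof.
  destruct (height_unbounded m) as [b [Hb Hbm]].
  (* A run of height [y < m0] cannot land at or below zero, and [y < m]; so both arguments of the
     minimum are positive at its parameter [p0]. *)
  set (y := Rmin m0 m / 2).
  assert (Hy : 0 < y < m0 /\ y < m).
  { unfold y. pose proof (Rmin_l m0 m). pose proof (Rmin_r m0 m).
    pose proof (Rmin_glb_lt m0 m 0 Hm0 Hm). lra. }
  destruct (IVT_gen height 0 b y height_continuous) as [p0 [Hp0 Hhp0]].
  { rewrite height_0, Rmin_left, Rmax_right; lra. }
  rewrite Rmin_left, Rmax_right in Hp0 by lra.
  assert (Hp0' : 0 < p0).
  { destruct Hp0 as [[H|H] _]; [exact H|]. subst p0. rewrite height_0 in Hhp0. lra. }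
  assert (HpN : 0 < U p0 N).
  { apply Rnot_le_lt. intros Hle. pose proof (shoot_landing_height p0 Hle). lra. }
  (* Searching between [p0] and [b] keeps the zero away from the trivial run [p = 0]. *)
  destruct (IVT_gen (fun p => Rmin (U p N) (m - height p)) p0 b 0) as [p [Hp Hz]].
  { apply continuity_Rmin; [exact continuity_landing|].
    exact (continuity_minus _ _ (continuity_cst m) height_continuous). }
  { split.
    - apply Rle_trans with (1 := Rmin_r _ _), Rle_trans with (1 := Rmin_r _ _). lra.
    - apply Rle_trans with (2 := Rmax_l _ _). left. apply Rmin_glb_lt; lra. }
  assert (Hpp : 0 < p) by (apply Rlt_le_trans with (2 := proj1 Hp); apply Rmin_glb_lt; lra).
  assert (Hc : U p N = 0 /\ height p <= m).
  { unfold Rmin in Hz. destruct (Rle_dec (U p N) (m - height p)).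
    - split; lra.
    - exfalso. apply (shoot_height_ne p); lra. }
  destruct (shoot_landing_height p ltac:(lra) (height_pos p Hpp)) as [Hlo _].
  unfold height in *. destruct (max_upto_attained (U p) N) as [k [Hk Hhk]].
  rewrite Hhk in *. exists (U p), (W p), k. repeat split; try apply shoot_scheme; try apply Hk; lra.
Qed.

(** With [height - m] in the minimum, [p = 0] can serve as an end point: the zero found has height
    at least [m], so it is not the trivial run. At [b] the height exceeds both [m] and [m1], so that
    run ends above zero. *)
Lemma high_discrete_solution : exists u w k, discrete_solution u w k /\ m <= u k <= m1.
Proof.
  destruct (height_unbounded (Rmax m m1 + 1)) as [b [Hb Hbm]].
  pose proof (Rmax_l m m1). pose proof (Rmax_r m m1).
  assert (HbN : 0 < U b N).
  { apply Rnot_le_lt. intros Hle.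
    pose proof (shoot_landing_height b Hle (height_pos b Hb)). lra. }
  destruct (IVT_gen (fun p => Rmin (U p N) (height p - m)) 0 b 0) as [p [Hp Hz]].
  { apply continuity_Rmin; [exact continuity_landing|].
    exact (continuity_minus _ _ height_continuous (continuity_cst m)). }
  { split.
    - apply Rle_trans with (1 := Rmin_l _ _), Rle_trans with (1 := Rmin_r _ _).
      rewrite height_0. lra.
    - apply Rle_trans with (2 := Rmax_r _ _). left. apply Rmin_glb_lt; lra. }
  assert (Hc : U p N = 0 /\ m <= height p).
  { unfold Rmin in Hz. destruct (Rle_dec (U p N) (height p - m)).
    - split; lra.
    - exfalso. apply (shoot_height_ne p); lra. }
  destruct (shoot_landing_height p ltac:(lra) ltac:(lra)) as [_ Hhi].
  unfold height in *. destruct (max_upto_attained (U p) N) as [k [Hk Hhk]].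
  rewrite Hhk in *. exists (U p), (W p), k. repeat split; try apply shoot_scheme; try apply Hk; lra.
Qed.

End Shooting.

(** * Passage to the limit *)

Definition cell (x : R) : nat := Z.to_nat (Int_part x).

Lemma cell_spec (x : R) : 0 <= x -> INR (cell x) <= x < INR (cell x) + 1.
Proof.
  intros Hx. destruct (base_Int_part x) as [H1 H2]. unfold cell.
  assert (H0 : (-1 < Int_part x)%Z) by (apply lt_IZR; lra).
  rewrite INR_IZR_INZ, Z2Nat.id by lia. lra.
Qed.

Lemma cell_le (x y : R) : 0 <= x <= y -> (cell x <= cell y)%nat.
Proof.
  intros Hxy. pose proof (cell_spec x ltac:(lra)). pose proof (cell_spec y ltac:(lra)).
  apply Nat.lt_succ_r, INR_lt. rewrite S_INR. lra.
Qed.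

(** Two-sided increment bounds over ordered pairs near [x] are what survives the limit of discrete
    runs; difference quotients are the pairs with one end at [x]. *)
Lemma derivable_pt_lim_squeeze (F : R -> R) (x l : R) :
  (forall eps, 0 < eps -> exists eta, 0 < eta /\ forall s t, x - eta < s -> s <= t -> t < x + eta ->
     (l - eps) * (t - s) <= F t - F s <= (l + eps) * (t - s)) ->
  derivable_pt_lim F x l.
Proof.
  intros H eps He. destruct (H (eps / 2) ltac:(lra)) as [eta [Heta Hs]].
  exists (mkposreal eta Heta). intros d Hd0 Hd. simpl in Hd. apply Rabs_def2 in Hd.
  assert (Hb : l - eps / 2 <= (F (x + d) - F x) / d <= l + eps / 2).
  { destruct (Rlt_dec 0 d) as [Hpos|Hneg].
    - destruct (Hs x (x + d) ltac:(lra) ltac:(lra) ltac:(lra)) as [H1 H2].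
      replace (x + d - x) with d in * by ring.
      split; apply Rmult_le_reg_r with d; try lra; unfold Rdiv at 2;
        unfold Rdiv; rewrite ?Rmult_assoc, ?Rinv_l; unfold Rdiv in *; lra.
    - destruct (Hs (x + d) x ltac:(lra) ltac:(lra) ltac:(lra)) as [H1 H2].
      replace (x - (x + d)) with (- d) in * by ring.
      replace ((F (x + d) - F x) / d) with ((F x - F (x + d)) / (- d)) by (field; lra).
      split; apply Rmult_le_reg_r with (- d); try lra.
      + replace ((F x - F (x + d)) / - d * - d) with (F x - F (x + d)) by (field; lra). lra.
      + replace ((F x - F (x + d)) / - d * - d) with (F x - F (x + d)) by (field; lra). lra. }
  apply Rabs_def1; lra.
Qed.

Section Limit.

Variable U : (nat -> Prop) -> Prop.
Hypothesis HU : free_ultrafilter U.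
Variables (glo ghi : R -> R) (C : R).
Hypothesis Hgauge : gauges glo ghi C.
Hypothesis glo_unbounded : forall y, exists x, 0 < x /\ y <= glo x.
Variable G : R -> R -> R.
Hypothesis G_response : forall t, 0 < t < 1 -> response glo ghi (G t).
Hypothesis G_cont : forall t w, 0 < t < 1 -> forall eps, 0 < eps -> exists eta, 0 < eta /\
  forall s v, Rabs (s - t) < eta -> Rabs (v - w) < eta -> Rabs (G s v - G t w) < eps.
Variables A h : R -> R.
Hypothesis A_le : forall s t, 0 < s -> s <= t -> t < 1 -> A s <= A t.
Hypothesis A_deriv : forall t, 0 < t < 1 -> forall eps, 0 < eps -> exists eta, 0 < eta /\
  forall x y, t - eta < x -> x <= y -> y < t + eta ->
  (h t - eps) * (y - x) <= A y - A x <= (h t + eps) * (y - x).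
Hypothesis A_cont : forall t, 0 < t < 1 -> continuity_pt A t.
Hypothesis h_pos : forall t, 0 < t < 1 -> 0 <= h t.
Variable fe : R -> R.
Hypothesis fe_pos : forall s, 0 <= fe s.
Hypothesis fe_cont : continuity fe.
Variable lam : R.
Hypothesis lam_pos : 0 < lam.
Variables (KL EL KR ER : R -> R) (B : R).
Hypothesis HtailL : tail_majorant KL EL B.
Hypothesis HtailR : tail_majorant KR ER B.
Hypothesis ghi_tailL : forall P F, 0 <= P -> 0 <= F -> exists C1 Q, 0 <= C1 /\ 0 <= Q /\
  forall x, 0 < x <= 1/2 -> ghi (P + F * (A (1/2) - A x)) <= C1 + Q * KL x.
Hypothesis ghi_tailR : forall P F, 0 <= P -> 0 <= F -> exists C1 Q, 0 <= C1 /\ 0 <= Q /\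
  forall x, 0 < x <= 1/2 -> ghi (P + F * (A (1 - x) - A (1/2))) <= C1 + Q * KR x.
Hypothesis EL_0 : forall eps, 0 < eps -> exists eta, 0 < eta <= 1/2 /\ EL eta < eps.
Hypothesis ER_0 : forall eps, 0 < eps -> exists eta, 0 < eta <= 1/2 /\ ER eta < eps.

Definition midpoint (N i : nat) : R := (INR i + /2) / INR N.

(* An odd number of cells puts [1/2] at the midpoint of the central one. *)
Variable K : nat -> nat.
Hypothesis HK : forall n, (n <= K n)%nat.
Let N (n : nat) : nat := (2 * K n + 1)%nat.
Variables (u w : nat -> nat -> R) (k : nat -> nat) (mlo mhi : R).
Hypothesis mlo_pos : 0 < mlo.
Hypothesis Hsol : forall n,
  discrete_solution (N n) fe lam (fun i => A (midpoint (N n) i)) (fun i => G (midpoint (N n) i))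
    (u n) (w n) (k n).
Hypothesis Hheight : forall n, mlo <= u n (k n) <= mhi.

Lemma N_pos (n : nat) : (0 < N n)%nat.
Proof. unfold N. lia. Qed.

Lemma INR_N_pos (n : nat) : 0 < INR (N n).
Proof. apply lt_0_INR, N_pos. Qed.

Lemma mesh_small (eps : R) : 0 < eps -> U (fun n => / INR (N n) < eps).
Proof.
  intros He. destruct (archimed_cor1 eps He) as [n0 [H1 H2]].
  apply (fu_eventually U HU _ n0). intros n Hn. apply Rle_lt_trans with (2 := H1).
  apply Rinv_le_contravar; [apply lt_0_INR; lia|]. apply le_INR. unfold N.
  specialize (HK n). lia.
Qed.

Lemma midpoint_open (n i : nat) : (i < N n)%nat -> 0 < midpoint (N n) i < 1.
Proof.
  intros Hi. pose proof (INR_N_pos n). pose proof (pos_INR i).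
  apply le_INR in Hi. rewrite S_INR in Hi. unfold midpoint. split.
  - apply Rdiv_lt_0_compat; lra.
  - apply Rmult_lt_reg_r with (INR (N n)); [lra|]. unfold Rdiv.
    rewrite Rmult_assoc, Rinv_l; lra.
Qed.

Lemma midpoint_le (n i j : nat) : (i <= j)%nat -> midpoint (N n) i <= midpoint (N n) j.
Proof.
  intros Hij. apply le_INR in Hij. apply Rmult_le_compat_r; [|lra].
  left. apply Rinv_0_lt_compat, INR_N_pos.
Qed.

Lemma midpoint_center (n : nat) : midpoint (N n) (K n) = 1/2.
Proof.
  pose proof (INR_N_pos n) as H. unfold midpoint, N in *.
  rewrite plus_INR, mult_INR in *. simpl (INR 2) in *. simpl (INR 1) in *. field. lra.
Qed.

Lemma midpoint_reflect (n i : nat) : (i <= K n)%nat ->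
  midpoint (N n) (2 * K n - i) = 1 - midpoint (N n) i.
Proof.
  intros Hi. pose proof (INR_N_pos n) as H. unfold midpoint, N in *.
  rewrite minus_INR by lia. rewrite plus_INR, mult_INR in *.
  simpl (INR 2) in *. simpl (INR 1) in *. field. lra.
Qed.

Lemma admissible_grid (n : nat) :
  admissible glo ghi (N n) (fun i => A (midpoint (N n) i)) (fun i => G (midpoint (N n) i)).
Proof.
  split; intros i Hi.
  - pose proof (midpoint_open n i ltac:(lia)). pose proof (midpoint_open n (S i) Hi).
    apply A_le; [lra | apply midpoint_le; lia | lra].
  - apply G_response, midpoint_open, Hi.
Qed.

(** The cell containing [t], used also as the node at the left end of that cell. *)
Let idx (n : nat) (t : R) : nat := cell (INR (N n) * t).

Lemma idx_spec (n : nat) (t : R) : 0 <= t ->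
  INR (idx n t) / INR (N n) <= t < INR (idx n t) / INR (N n) + / INR (N n).
Proof.
  intros Ht. pose proof (INR_N_pos n) as HN.
  destruct (cell_spec (INR (N n) * t)) as [H1 H2]; [apply Rmult_le_pos; lra|].
  fold (idx n t) in *. split.
  - apply Rmult_le_reg_r with (INR (N n)); [lra|]. unfold Rdiv. rewrite Rmult_assoc, Rinv_l; lra.
  - apply Rmult_lt_reg_r with (INR (N n)); [lra|].
    rewrite Rmult_plus_distr_r. unfold Rdiv. rewrite Rmult_assoc, Rinv_l; lra.
Qed.

Lemma idx_lt (n : nat) (t : R) : 0 <= t < 1 -> (idx n t < N n)%nat.
Proof.
  intros Ht. pose proof (INR_N_pos n).
  destruct (cell_spec (INR (N n) * t)) as [H1 H2]; [apply Rmult_le_pos; lra|].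
  apply INR_lt. fold (idx n t) in *. nra.
Qed.

Lemma idx_le (n : nat) (s t : R) : 0 <= s <= t -> (idx n s <= idx n t)%nat.
Proof.
  intros Hst. pose proof (INR_N_pos n). apply cell_le. split.
  - apply Rmult_le_pos; lra.
  - apply Rmult_le_compat_l; lra.
Qed.

Lemma idx_right (n : nat) (t : R) : 0 <= t < 1 ->
  1 - t <= INR (N n - idx n t) / INR (N n) < 1 - t + / INR (N n).
Proof.
  intros Ht. pose proof (idx_lt n t Ht). pose proof (idx_spec n t ltac:(lra)).
  pose proof (INR_N_pos n). rewrite minus_INR by lia.
  replace ((INR (N n) - INR (idx n t)) / INR (N n)) with (1 - INR (idx n t) / INR (N n))
    by (field; lra). lra.
Qed.

Lemma idx_ulim (t : R) : 0 <= t -> ulim U (fun n => INR (idx n t) / INR (N n)) t.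
Proof.
  intros Ht eps He. apply (fu_sub U HU _ _) with (2 := mesh_small eps He). intros n Hn.
  pose proof (idx_spec n t Ht). apply Rabs_def1; lra.
Qed.

Lemma A_ulim (t : R) : 0 < t < 1 -> ulim U (fun n => A (midpoint (N n) (idx n t))) (A t).
Proof.
  intros Ht. apply (ulim_continuity U HU A); [now apply A_cont|].
  intros eps He. apply (fu_sub U HU _ _) with (2 := mesh_small eps He). intros n Hn.
  pose proof (idx_spec n t ltac:(lra)) as Hs. pose proof (INR_N_pos n).
  assert (0 < / INR (N n)) by now apply Rinv_0_lt_compat.
  unfold midpoint. replace ((INR (idx n t) + / 2) / INR (N n))
    with (INR (idx n t) / INR (N n) + / 2 * / INR (N n)) by (field; lra).
  apply Rabs_def1; lra.
Qed.

Lemma u_bounds (n i : nat) : (i <= N n)%nat -> 0 <= u n i <= mhi.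
Proof.
  intros Hi. destruct (Hsol n) as [Hrun [H0 [HN0 [Hk Hmax]]]]. destruct (Hheight n).
  split; [|apply Rle_trans with (u n (k n)); [now apply Hmax | lra]].
  pose proof (gauge_pos _ _ _ Hgauge).
  pose proof (INR_frac_bound i (N n) (N_pos n) Hi).
  pose proof (INR_frac_bound (N n - i) (N n) (N_pos n) ltac:(lia)).
  (* With [theta = 0] the cone estimate is nonnegativity. *)
  pose proof (cone glo ghi C Hgauge (N n) (N_pos n) fe fe_pos lam lam_pos _ _ _ _ (k n) i 0
    (admissible_grid n) Hrun ltac:(lra) ltac:(lra) Hk Hmax Hi ltac:(lra) ltac:(lra)).
  nra.
Qed.

Lemma flux_antitone_grid (n i j : nat) : (i <= j < N n)%nat -> w n j <= w n i.
Proof.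
  apply (flux_antitone glo ghi (N n) (N_pos n) fe fe_pos lam lam_pos _ _ _ _ (admissible_grid n)
    (proj1 (Hsol n))).
Qed.

(** Interior bound from [flux_bound] with [theta] the distance of [t] to the boundary; [P] is chosen
    with [glo P] at least [mhi / theta] and so degenerates at the ends. *)
Lemma flux_bounded (t : R) : 0 < t < 1 -> exists P, 0 <= P /\ forall n, Rabs (w n (idx n t)) <= P.
Proof.
  intros Ht. set (theta := Rmin t (1 - t)).
  assert (Hth : 0 < theta) by (apply Rmin_glb_lt; lra).
  destruct (glo_unbounded (mhi / theta)) as [P [HP HgP]].
  exists P. split; [lra|]. intros n. apply (glo_le_inv glo ghi C Hgauge).
  apply Rle_trans with (2 := HgP). apply Rmult_le_reg_l with theta; [exact Hth|].
  replace (theta * (mhi / theta)) with mhi by (field; lra).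
  destruct (Hsol n) as [Hrun [H0 [HN0 _]]].
  pose proof (idx_lt n t ltac:(lra)). pose proof (idx_right n t ltac:(lra)).
  pose proof (idx_spec n t ltac:(lra)). pose proof (INR_N_pos n).
  apply (flux_bound glo ghi C Hgauge (N n) (N_pos n) fe fe_pos lam lam_pos _ _ _ _ _ theta mhi
    (admissible_grid n) Hrun); try lra; auto.
  - intros j Hj. now apply u_bounds.
  - apply Rle_trans with (1 := Rmin_l _ _). rewrite S_INR.
    replace ((INR (idx n t) + 1) / INR (N n)) with (INR (idx n t) / INR (N n) + / INR (N n))
      by (field; lra). lra.
  - apply Rle_trans with (1 := Rmin_r _ _). lra.
Qed.

Lemma flux_bounded_between (s t : R) : 0 < s -> s <= t -> t < 1 ->
  exists P, 0 <= P /\ forall n i, (idx n s <= i <= idx n t)%nat -> Rabs (w n i) <= P.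
Proof.
  intros Hs Hst Ht. destruct (flux_bounded s ltac:(lra)) as [P1 [HP1 H1]].
  destruct (flux_bounded t ltac:(lra)) as [P2 [HP2 H2]].
  exists (P1 + P2). split; [lra|]. intros n i Hi.
  pose proof (idx_lt n t ltac:(lra)).
  pose proof (flux_antitone_grid n (idx n s) i ltac:(lia)).
  pose proof (flux_antitone_grid n i (idx n t) ltac:(lia)).
  specialize (H1 n). specialize (H2 n). apply Rabs_le_between in H1, H2.
  apply Rabs_le. lra.
Qed.

Lemma limits_exist : exists us ws : R -> R,
  (forall t, 0 < t < 1 -> ulim U (fun n => u n (idx n t)) (us t) /\
                          ulim U (fun n => w n (idx n t)) (ws t)) /\
  (forall t, ~ 0 < t < 1 -> us t = 0).
Proof.
  (* The value 0 outside the open interval fixes the boundary values by definition; continuity there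
     is shown separately. *)
  assert (H1 : forall t, exists l, (0 < t < 1 -> ulim U (fun n => u n (idx n t)) l) /\
                                   (~ 0 < t < 1 -> l = 0)).
  { intros t. destruct (classic (0 < t < 1)) as [Ht|Ht].
    - destruct (ulim_exists U HU (fun n => u n (idx n t)) mhi) as [l Hl].
      + apply (fu_all U HU). intros n. pose proof (idx_lt n t ltac:(lra)).
        pose proof (u_bounds n (idx n t) ltac:(lia)). apply Rabs_le. lra.
      + exists l. split; [auto | intros; contradiction].
    - exists 0. split; [intros; contradiction | auto]. }
  assert (H2 : forall t, exists l, 0 < t < 1 -> ulim U (fun n => w n (idx n t)) l).
  { intros t. destruct (classic (0 < t < 1)) as [Ht|Ht].
    - destruct (flux_bounded t Ht) as [P [_ HP]].
      destruct (ulim_exists U HU (fun n => w n (idx n t)) P) as [l Hl].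
      + now apply (fu_all U HU).
      + exists l. auto.
    - exists 0. intros; contradiction. }
  destruct (functional_choice _ H1) as [us Hus]. destruct (functional_choice _ H2) as [ws Hws].
  exists us, ws. split; [|intros; now apply Hus].
  intros t Ht. split; [now apply Hus | now apply Hws].
Qed.

(** * Differentiability of the limit and its equation *)

Section LimitFunctions.

Variables us ws : R -> R.
Hypothesis us_lim : forall t, 0 < t < 1 -> ulim U (fun n => u n (idx n t)) (us t).
Hypothesis ws_lim : forall t, 0 < t < 1 -> ulim U (fun n => w n (idx n t)) (ws t).

Lemma us_bounds (t : R) : 0 < t < 1 -> 0 <= us t <= mhi.
Proof.
  intros Ht. split.
  - apply (ulim_ge_const U HU _ _ _ (us_lim t Ht)). apply (fu_all U HU). intros n.
    pose proof (idx_lt n t ltac:(lra)). apply u_bounds. lia.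
  - apply (ulim_le_const U HU _ _ _ (us_lim t Ht)). apply (fu_all U HU). intros n.
    pose proof (idx_lt n t ltac:(lra)). apply u_bounds. lia.
Qed.

Lemma us_cone (t theta : R) : 0 < theta -> theta < t -> theta < 1 - t ->
  theta * mlo <= (1 + C) * us t.
Proof.
  intros H1 H2 H3. assert (Ht : 0 < t < 1) by lra.
  apply (ulim_ge_const U HU _ _ _ (ulim_scal U HU (1 + C) _ _ (us_lim t Ht))).
  (* The node [idx n t] may lie a mesh width to the left of [t]; the strict inequality [theta < t]
     absorbs this. *)
  apply (fu_sub U HU _ _) with (2 := mesh_small (t - theta) ltac:(lra)). intros n Hn.
  destruct (Hsol n) as [Hrun [H0 [HN0 [Hk Hmax]]]]. destruct (Hheight n).
  pose proof (idx_lt n t ltac:(lra)). pose proof (idx_spec n t ltac:(lra)).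
  pose proof (idx_right n t ltac:(lra)).
  apply Rle_trans with (theta * u n (k n)); [apply Rmult_le_compat_l; lra|].
  apply (cone glo ghi C Hgauge (N n) (N_pos n) fe fe_pos lam lam_pos _ _ _ _ (k n) _ theta
    (admissible_grid n) Hrun); auto; try lra. lia.
Qed.

(** Equicontinuity in the interior, from bounded fluxes. A whole range of nodes is controlled on one
    large set of [n], because the flux recursion evaluates [fe] at all of them. *)
Lemma u_locally_constant (t : R) : 0 < t < 1 -> forall eps, 0 < eps ->
  exists eta, 0 < eta /\ 0 < t - eta /\ t + eta < 1 /\
  U (fun n => forall j, (idx n (t - eta) <= j <= idx n (t + eta))%nat -> Rabs (u n j - us t) < eps).
Proof.
  intros Ht eps He. set (r := Rmin t (1 - t) / 2).
  assert (Hr : 0 < r /\ r < t /\ r < 1 - t).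
  { unfold r. pose proof (Rmin_l t (1 - t)). pose proof (Rmin_r t (1 - t)).
    pose proof (Rmin_glb_lt t (1 - t) 0 ltac:(lra) ltac:(lra)). lra. }
  destruct (flux_bounded_between (t - r) (t + r)) as [P [HP HwP]]; try lra.
  set (L := ghi P + 1).
  assert (HL : 1 <= L).
  { unfold L. assert (ghi 0 <= ghi P) by now apply (ghi_le _ _ _ Hgauge).
    rewrite (ghi_0 _ _ _ Hgauge) in *. lra. }
  (* The nodes concerned span [2 * eta] plus a mesh width, at most [3 * eta]; the factor 6 makes the
     resulting change of [u] at most [eps / 2]. *)
  set (eta := Rmin r (eps / (6 * L))).
  assert (Heta : 0 < eta) by (apply Rmin_glb_lt; [lra | apply Rdiv_lt_0_compat; lra]).
  assert (Hetar : eta <= r) by apply Rmin_l.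
  assert (HetaL : 3 * L * eta <= eps / 2).
  { apply Rle_trans with (3 * L * (eps / (6 * L))).
    - apply Rmult_le_compat_l; [lra | apply Rmin_r].
    - right. field. lra. }
  exists eta. repeat split; try lra.
  apply (fu_sub U HU _ _) with (2 := fu_and U HU _ _ (mesh_small eta Heta)
    (us_lim t Ht (eps / 2) ltac:(lra))).
  intros n [Hmesh Hlim] j Hj.
  assert (Hinc : forall p q, (idx n (t - eta) <= p <= q)%nat -> (q <= idx n (t + eta))%nat ->
            Rabs (u n q - u n p) <= 3 * eta * L).
  { intros p q Hp Hq.
    pose proof (idx_le n (t - r) (t - eta) ltac:(lra)).
    pose proof (idx_le n (t + eta) (t + r) ltac:(lra)).
    pose proof (idx_lt n (t + r) ltac:(lra)).
    destruct (increment_bounds (N n) (N_pos n) fe lam _ _ _ _ (proj1 (Hsol n)) p q (- L) L)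
      as [Hlo Hhi]; [lia | |].
    - intros i Hi. apply Rabs_le_between.
      apply Rle_trans with (ghi P); [|unfold L; lra].
      apply (response_abs_le glo ghi C Hgauge).
      + apply G_response, midpoint_open. lia.
      + apply HwP. lia.
    - assert (Hpq : 0 <= (INR q - INR p) / INR (N n) <= 3 * eta).
      { pose proof (idx_spec n (t - eta) ltac:(lra)). pose proof (idx_spec n (t + eta) ltac:(lra)).
        pose proof (INR_N_pos n) as HNp. assert (0 < / INR (N n)) by now apply Rinv_0_lt_compat.
        assert (INR p <= INR q) by (apply le_INR; lia).
        assert (Hp' : INR (idx n (t - eta)) / INR (N n) <= INR p / INR (N n)).
        { apply Rmult_le_compat_r; [lra|]. apply le_INR. lia. }
        assert (Hq' : INR q / INR (N n) <= INR (idx n (t + eta)) / INR (N n)).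
        { apply Rmult_le_compat_r; [lra|]. apply le_INR. lia. }
        replace ((INR q - INR p) / INR (N n)) with (INR q / INR (N n) - INR p / INR (N n))
          by (field; lra).
        split; [|lra].
        assert (INR p / INR (N n) <= INR q / INR (N n)) by (apply Rmult_le_compat_r; lra). lra. }
      apply Rabs_le. nra. }
  assert (Hc : (idx n (t - eta) <= idx n t <= idx n (t + eta))%nat)
    by (split; apply idx_le; lra).
  assert (Hd : Rabs (u n j - u n (idx n t)) <= 3 * eta * L).
  { destruct (Nat.le_ge_cases (idx n t) j).
    - apply Hinc; lia.
    - rewrite Rabs_minus_sym. apply Hinc; lia. }
  apply Rabs_le_between in Hd. apply Rabs_def2 in Hlim. apply Rabs_def1; lra.
Qed.

(** Summing the flux recursion over the cells from [x] to [y] telescopes the primitive, while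
    equicontinuity freezes [fe] at [us t] up to [eps]. *)
Lemma ws_increment (t : R) : 0 < t < 1 -> forall eps, 0 < eps ->
  exists eta, 0 < eta /\ 0 < t - eta /\ t + eta < 1 /\
  forall x y, t - eta < x -> x <= y -> y < t + eta ->
  lam * (fe (us t) - eps) * (A y - A x) <= ws x - ws y <= lam * (fe (us t) + eps) * (A y - A x).
Proof.
  intros Ht eps He. destruct (continuity_pt_eps fe (us t) (fe_cont (us t)) eps He) as [d [Hd Hfe]].
  destruct (u_locally_constant t Ht d Hd) as [eta [Heta [H1 [H2 HUev]]]].
  exists eta. repeat (split; [assumption|]). intros x y Hx Hxy Hy.
  assert (Hlim : ulim U (fun n => w n (idx n x) - w n (idx n y)) (ws x - ws y))
    by (apply (ulim_minus U HU); apply ws_lim; lra).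
  assert (HA : ulim U (fun n => A (midpoint (N n) (idx n y)) - A (midpoint (N n) (idx n x)))
                 (A y - A x)) by (apply (ulim_minus U HU); apply A_ulim; lra).
  assert (Hev : U (fun n => forall j, (idx n x < j <= idx n y)%nat ->
                   fe (us t) - eps <= fe (u n j) <= fe (us t) + eps)).
  { apply (fu_sub U HU _ _) with (2 := HUev). intros n Hn j Hj.
    pose proof (idx_le n (t - eta) x ltac:(lra)). pose proof (idx_le n y (t + eta) ltac:(lra)).
    specialize (Hfe (u n j) (Hn j ltac:(lia))). apply Rabs_def2 in Hfe. lra. }
  assert (Hidx : forall n, (idx n x <= idx n y < N n)%nat)
    by (intros n; split; [apply idx_le; lra | apply idx_lt; lra]).
  split.
  - apply (ulim_le U HU) with (1 := ulim_scal U HU _ _ _ HA) (2 := Hlim).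
    apply (fu_sub U HU _ _) with (2 := Hev). intros n Hn.
    apply (flux_drop_ge glo ghi (N n) (N_pos n) fe lam lam_pos _ _ _ _ (admissible_grid n)
      (proj1 (Hsol n))); [apply Hidx | intros j Hj; now apply Hn].
  - apply (ulim_le U HU) with (1 := Hlim) (2 := ulim_scal U HU _ _ _ HA).
    apply (fu_sub U HU _ _) with (2 := Hev). intros n Hn.
    apply (flux_drop_le glo ghi (N n) (N_pos n) fe lam lam_pos _ _ _ _ (admissible_grid n)
      (proj1 (Hsol n))); [apply Hidx | intros j Hj; now apply Hn].
Qed.

Lemma ws_derivable (t : R) : 0 < t < 1 -> derivable_pt_lim ws t (- (lam * h t * fe (us t))).
Proof.
  intros Ht. apply derivable_pt_lim_squeeze. intros eps He.
  set (f0 := fe (us t)). assert (Hf0 : 0 <= f0) by apply fe_pos.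
  pose proof (h_pos t Ht) as Hh.
  (* The error splits into the one of [fe], weighted by an increment of [A], and the one of [A],
     weighted by [f0]; each gets [eps / 2]. The cap [e2 <= 1] bounds the increment of [A] by
     [(h t + 1) * dx]. *)
  set (e1 := eps / (2 * lam * (h t + 1))).
  assert (Hlh : 0 < 2 * lam * (h t + 1)) by (apply Rmult_lt_0_compat; lra).
  assert (He1 : 0 < e1) by now apply Rdiv_lt_0_compat.
  set (e2 := Rmin 1 (eps / (2 * lam * (f0 + 1)))).
  assert (Hlf : 0 < 2 * lam * (f0 + 1)) by (apply Rmult_lt_0_compat; lra).
  assert (He2 : 0 < e2) by (apply Rmin_glb_lt; [lra | now apply Rdiv_lt_0_compat]).
  destruct (ws_increment t Ht e1 He1) as [eta1 [Heta1 [H1 [H2 Hw]]]].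
  destruct (A_deriv t Ht e2 He2) as [eta2 [Heta2 HA]].
  exists (Rmin eta1 eta2). split; [now apply Rmin_glb_lt|].
  pose proof (Rmin_l eta1 eta2). pose proof (Rmin_r eta1 eta2).
  intros x y Hx Hxy Hy.
  specialize (Hw x y ltac:(lra) Hxy ltac:(lra)). specialize (HA x y ltac:(lra) Hxy ltac:(lra)).
  assert (HA0 : A x <= A y) by (apply A_le; lra).
  fold f0 in Hw.
  assert (E1 : lam * e1 * (h t + 1) = eps / 2) by (unfold e1; field; lra).
  assert (E2 : lam * e2 * f0 <= eps / 2).
  { apply Rle_trans with (lam * (eps / (2 * lam * (f0 + 1))) * (f0 + 1)).
    - apply Rmult_le_compat; try lra.
      + apply Rmult_le_pos; lra.
      + apply Rmult_le_compat_l; [lra | apply Rmin_r].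
    - right. field. lra. }
  assert (E3 : e2 <= 1) by apply Rmin_l.
  set (D := A y - A x) in *. set (dx := y - x) in *.
  assert (Hdx : 0 <= dx) by (unfold dx; lra).
  assert (B1 : lam * e1 * D <= eps / 2 * dx).
  { rewrite <- E1. rewrite Rmult_assoc. rewrite (Rmult_assoc (lam * e1)).
    rewrite <- Rmult_assoc. apply Rmult_le_compat_l; [apply Rmult_le_pos; lra|]. nra. }
  assert (B2 : lam * f0 * (h t * dx) - eps / 2 * dx <= lam * f0 * D).
  { assert (lam * f0 * (h t * dx - e2 * dx) <= lam * f0 * D)
      by (apply Rmult_le_compat_l; [apply Rmult_le_pos; lra | lra]). nra. }
  assert (B3 : lam * f0 * D <= lam * f0 * (h t * dx) + eps / 2 * dx).
  { assert (lam * f0 * D <= lam * f0 * (h t * dx + e2 * dx))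
      by (apply Rmult_le_compat_l; [apply Rmult_le_pos; lra | lra]). nra. }
  lra.
Qed.

Lemma ws_continuous (t : R) : 0 < t < 1 -> continuity_pt ws t.
Proof.
  intros Ht. apply derivable_continuous_pt. exists (- (lam * h t * fe (us t))).
  now apply ws_derivable.
Qed.

(** By monotonicity, convergence of the fluxes at the two points [t - eta] and [t + eta] controls
    the fluxes of all cells in between. *)
Lemma us_derivable (t : R) : 0 < t < 1 -> derivable_pt_lim us t (G t (ws t)).
Proof.
  intros Ht. apply derivable_pt_lim_squeeze. intros eps He.
  destruct (G_cont t (ws t) Ht eps He) as [d [Hd HG]].
  destruct (continuity_pt_eps ws t (ws_continuous t Ht) (d / 2) ltac:(lra)) as [r [Hr Hws]].
  set (eta := Rmin (Rmin (r / 2) (d / 2)) (Rmin (t / 2) ((1 - t) / 2))).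
  assert (Heta : 0 < eta) by (repeat apply Rmin_glb_lt; lra).
  assert (Hle : eta <= r / 2 /\ eta <= d / 2 /\ eta <= t / 2 /\ eta <= (1 - t) / 2).
  { unfold eta. repeat split.
    - apply Rle_trans with (1 := Rmin_l _ _), Rmin_l.
    - apply Rle_trans with (1 := Rmin_l _ _), Rmin_r.
    - apply Rle_trans with (1 := Rmin_r _ _), Rmin_l.
    - apply Rle_trans with (1 := Rmin_r _ _), Rmin_r. }
  exists eta. split; [exact Heta|]. intros x y Hx Hxy Hy.
  assert (Hw1 : Rabs (ws (t - eta) - ws t) < d / 2) by (apply Hws, Rabs_def1; lra).
  assert (Hw2 : Rabs (ws (t + eta) - ws t) < d / 2) by (apply Hws, Rabs_def1; lra).
  apply Rabs_def2 in Hw1, Hw2.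
  assert (Hev : U (fun n => forall j, (idx n x <= j < idx n y)%nat ->
     G t (ws t) - eps <= G (midpoint (N n) j) (w n j) <= G t (ws t) + eps)).
  { apply (fu_sub U HU _ _) with (2 := fu_and U HU _ _ (mesh_small (d / 2) ltac:(lra))
      (fu_and U HU _ _ (ws_lim (t - eta) ltac:(lra) (d / 2) ltac:(lra))
                       (ws_lim (t + eta) ltac:(lra) (d / 2) ltac:(lra)))).
    intros n [Hmesh [Hl1 Hl2]] j Hj. apply Rabs_def2 in Hl1, Hl2.
    pose proof (idx_le n (t - eta) x ltac:(lra)). pose proof (idx_le n y (t + eta) ltac:(lra)).
    pose proof (idx_lt n (t + eta) ltac:(lra)).
    pose proof (flux_antitone_grid n (idx n (t - eta)) j ltac:(lia)).
    pose proof (flux_antitone_grid n j (idx n (t + eta)) ltac:(lia)).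
    assert (Hmid : x - / INR (N n) < midpoint (N n) j < y).
    { pose proof (idx_spec n x ltac:(lra)). pose proof (idx_spec n y ltac:(lra)).
      pose proof (INR_N_pos n). assert (HNi : 0 < / INR (N n)) by now apply Rinv_0_lt_compat.
      unfold midpoint. replace ((INR j + / 2) / INR (N n))
        with (INR j / INR (N n) + / 2 * / INR (N n)) by (field; lra).
      assert (INR (idx n x) / INR (N n) <= INR j / INR (N n))
        by (apply Rmult_le_compat_r; [lra | apply le_INR; lia]).
      assert (INR j / INR (N n) + / INR (N n) <= INR (idx n y) / INR (N n)).
      { replace (INR j / INR (N n) + / INR (N n)) with (INR (S j) / INR (N n))
          by (rewrite S_INR; field; lra).
        apply Rmult_le_compat_r; [lra | apply le_INR; lia]. }
      lra. }
    assert (HGj : Rabs (G (midpoint (N n) j) (w n j) - G t (ws t)) < eps)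
      by (apply HG; apply Rabs_def1; lra).
    apply Rabs_def2 in HGj. lra. }
  assert (Hlim : ulim U (fun n => u n (idx n y) - u n (idx n x)) (us y - us x))
    by (apply (ulim_minus U HU); apply us_lim; lra).
  assert (Hdx : ulim U (fun n => INR (idx n y) / INR (N n) - INR (idx n x) / INR (N n)) (y - x))
    by (apply (ulim_minus U HU); apply idx_ulim; lra).
  assert (Hb : forall n lo hi, (forall j, (idx n x <= j < idx n y)%nat ->
            lo <= G (midpoint (N n) j) (w n j) <= hi) ->
            lo * (INR (idx n y) / INR (N n) - INR (idx n x) / INR (N n)) <=
              u n (idx n y) - u n (idx n x) <=
            hi * (INR (idx n y) / INR (N n) - INR (idx n x) / INR (N n))).
  { intros n lo hi H. pose proof (idx_lt n y ltac:(lra)). pose proof (idx_le n x y ltac:(lra)).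
    pose proof (increment_bounds (N n) (N_pos n) fe lam _ _ _ _ (proj1 (Hsol n))
      (idx n x) (idx n y) lo hi ltac:(lia) H) as Hi.
    unfold Rdiv in *. rewrite Rmult_minus_distr_r in Hi. lra. }
  split.
  - apply (ulim_le U HU) with (1 := ulim_scal U HU _ _ _ Hdx) (2 := Hlim).
    apply (fu_sub U HU _ _) with (2 := Hev). intros n Hn. now apply (Hb n _ _ Hn).
  - apply (ulim_le U HU) with (1 := Hlim) (2 := ulim_scal U HU _ _ _ Hdx).
    apply (fu_sub U HU _ _) with (2 := Hev). intros n Hn. now apply (Hb n _ _ Hn).
Qed.

(** * Boundary values of the limit *)

Lemma fe_bounded : exists F, 0 <= F /\ forall n j, (j <= N n)%nat -> fe (u n j) <= F.
Proof.
  assert (Hmhi : 0 <= mhi) by (pose proof (Hheight O); lra).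
  destruct (continuity_ab_maj fe 0 mhi Hmhi) as [x [Hx _]].
  - intros s _. apply fe_cont.
  - exists (fe x). split; [apply fe_pos|]. intros n j Hj. apply Hx. now apply u_bounds.
Qed.

(** Stated for arbitrary runs so that the given runs and their reversals are both instances; [eta]
    precedes [n], so the modulus passes to the limit. *)
Lemma boundary_modulus (Kf E Y : R -> R) (a : nat -> nat -> R) (g : nat -> nat -> R -> R)
    (v z : nat -> nat -> R) (P F : R) :
  tail_majorant Kf E B ->
  (forall eps, 0 < eps -> exists eta, 0 < eta <= 1/2 /\ E eta < eps) ->
  (exists C1 Q, 0 <= C1 /\ 0 <= Q /\
     forall x, 0 < x <= 1/2 -> ghi (P + lam * F * Y x) <= C1 + Q * Kf x) ->
  0 <= P ->
  (forall n, admissible glo ghi (N n) (a n) (g n)) ->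
  (forall n, shooting_scheme (N n) (a n) (g n) lam fe (v n) (z n)) ->
  (forall n, v n O = 0) -> (forall n, z n (K n) <= P) ->
  (forall n j, (j <= N n)%nat -> fe (v n j) <= F) ->
  (forall n j, (j <= K n)%nat -> a n (K n) - a n j = Y (midpoint (N n) j)) ->
  forall eps, 0 < eps -> exists eta, 0 < eta /\
    forall n i, (i <= N n)%nat -> INR i / INR (N n) <= eta -> v n i <= eps.
Proof.
  intros Htail HE0 [C1 [Q [HC1 [HQ Hg]]]] HP Hadm Hrun Hv0 HzK HvF HY eps He.
  destruct (HE0 (eps / (4 * (Q + 1)))) as [e1 [He1 HE1]]; [apply Rdiv_lt_0_compat; lra|].
  set (eta := Rmin e1 (eps / (2 * (C1 + 1)))).
  assert (Heta : 0 < eta) by (apply Rmin_glb_lt; [lra | apply Rdiv_lt_0_compat; lra]).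
  assert (Heta1 : eta <= e1) by apply Rmin_l.
  exists eta. split; [exact Heta|]. intros n i Hi Hie.
  assert (HEeta : E eta <= E e1).
  { pose proof (tail_step _ _ _ Htail eta e1 ltac:(lra) ltac:(lra)).
    destruct (tail_pos _ _ _ Htail e1 ltac:(lra)) as [_ HKe].
    assert (0 <= Kf e1 * (e1 - eta)) by (apply Rmult_le_pos; lra). lra. }
  assert (Hbound : C1 * eta + 2 * Q * E eta <= eps).
  { assert (C1 * eta <= eps / 2).
    { apply Rle_trans with ((C1 + 1) * (eps / (2 * (C1 + 1)))).
      - apply Rmult_le_compat; try lra. apply Rmin_r.
      - right. field. lra. }
    assert (2 * Q * E eta <= eps / 2).
    { apply Rle_trans with (2 * (Q + 1) * (eps / (4 * (Q + 1)))).
      - apply Rmult_le_compat; try lra. apply (tail_pos _ _ _ Htail). lra.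
      - right. field. lra. }
    lra. }
  apply Rle_trans with (2 := Hbound).
  rewrite <- (Rminus_0_r (v n i)), <- (Hv0 n).
  apply (boundary_layer glo ghi C Hgauge (N n) (N_pos n) fe fe_pos lam lam_pos _ _ _ (z n) (K n) _
    Kf E B C1 Q P F eta (Hadm n) (Hrun n) Htail); auto; try lra.
  intros j Hj. rewrite (HY n j Hj). apply Hg.
  exact (midpoint_range (N n) (N_pos n) (K n) j eq_refl Hj).
Qed.

Lemma center_flux_bounded : exists P, 0 <= P /\ forall n, Rabs (w n (K n)) <= P.
Proof.
  destruct (flux_bounded (1/2) ltac:(lra)) as [P [HP HwP]].
  (* The cell containing [1/2] is the central one, since [1/2] is its midpoint. *)
  exists P. split; [exact HP|]. intros n. replace (K n) with (idx n (1/2)); [apply HwP|].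
  pose proof (idx_spec n (1/2) ltac:(lra)) as [Hs1 Hs2].
  pose proof (midpoint_center n) as Hm. unfold midpoint in Hm.
  pose proof (INR_N_pos n). assert (0 < / INR (N n)) by now apply Rinv_0_lt_compat.
  replace (INR (idx n (1 / 2)) / INR (N n) + / INR (N n))
    with ((INR (idx n (1/2)) + 1) / INR (N n)) in Hs2 by (field; lra).
  set (i := idx n (1/2)) in *. rewrite <- Hm in Hs1, Hs2.
  apply Rmult_le_reg_r in Hs1; [|lra]. apply Rmult_lt_reg_r in Hs2; [|lra].
  apply Nat.le_antisymm; apply Nat.lt_succ_r, INR_lt; rewrite S_INR; lra.
Qed.

Lemma us_vanishes_left (eps : R) : 0 < eps -> exists eta, 0 < eta /\
  forall t, 0 < t < 1 -> t < eta -> us t <= eps.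
Proof.
  intros He. destruct fe_bounded as [F [HF HFu]]. destruct center_flux_bounded as [P [HP HwP]].
  destruct (boundary_modulus KL EL (fun x => A (1/2) - A x)
    (fun n i => A (midpoint (N n) i)) (fun n i => G (midpoint (N n) i)) u w P F HtailL EL_0
    (ghi_tailL P (lam * F) HP ltac:(apply Rmult_le_pos; lra)) HP admissible_grid
    (fun n => proj1 (Hsol n)) (fun n => proj1 (proj2 (Hsol n)))
    (fun n => Rle_trans _ _ _ (Rle_abs _) (HwP n)) HFu) with (eps := eps) as [eta [Heta Hsm]].
  - intros n j _. now rewrite midpoint_center.
  - exact He.
  - exists eta. split; [exact Heta|]. intros t Ht Hte.
    apply (ulim_le_const U HU _ _ _ (us_lim t Ht)). apply (fu_all U HU). intros n.
    pose proof (idx_lt n t ltac:(lra)). pose proof (idx_spec n t ltac:(lra)).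
    apply Hsm; [lia | lra].
Qed.

Lemma us_vanishes_right (eps : R) : 0 < eps -> exists eta, 0 < eta /\
  forall t, 0 < t < 1 -> 1 - t < eta -> us t <= eps.
Proof.
  intros He. destruct fe_bounded as [F [HF HFu]]. destruct center_flux_bounded as [P [HP HwP]].
  pose proof (fun n => scheme_reverse glo ghi (N n) (N_pos n) fe lam _ _ _ _ (admissible_grid n)
    (proj1 (Hsol n))) as Hrev.
  destruct (boundary_modulus KR ER (fun x => A (1 - x) - A (1/2)) _ _ _ _ P F HtailR ER_0
    (ghi_tailR P (lam * F) HP ltac:(apply Rmult_le_pos; lra)) HP
    (fun n => proj1 (Hrev n)) (fun n => proj2 (Hrev n))) with (eps := eps) as [eta [Heta Hsm]];
    cbv beta in *.
  - intros n. rewrite Nat.sub_0_r. apply (Hsol n).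
  - intros n. replace (N n - 1 - K n)%nat with (K n) by (unfold N; lia).
    specialize (HwP n). rewrite <- Rabs_Ropp in HwP. exact (Rle_trans _ _ _ (Rle_abs _) HwP).
  - intros n j Hj. apply HFu. lia.
  - intros n j Hj. replace (N n - 1 - K n)%nat with (K n) by (unfold N; lia).
    replace (N n - 1 - j)%nat with (2 * K n - j)%nat by (unfold N; lia).
    rewrite midpoint_center, midpoint_reflect by assumption. ring.
  - exact He.
  - exists eta. split; [exact Heta|]. intros t Ht Hte.
    apply (ulim_le_const U HU _ _ _ (us_lim t Ht)).
    (* The reflected node may exceed [1 - t] by up to a mesh width. *)
    apply (fu_sub U HU _ _) with (2 := mesh_small (eta - (1 - t)) ltac:(lra)). intros n Hn.
    pose proof (idx_lt n t ltac:(lra)). pose proof (idx_right n t ltac:(lra)).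
    specialize (Hsm n (N n - idx n t)%nat ltac:(lia) ltac:(lra)).
    replace (N n - (N n - idx n t))%nat with (idx n t) in Hsm by lia. exact Hsm.
Qed.

End LimitFunctions.

Lemma limit_solution : exists us ws : R -> R,
  (forall t, ~ 0 < t < 1 -> us t = 0) /\
  (forall t, 0 < t < 1 -> 0 <= us t <= mhi /\ derivable_pt_lim us t (G t (ws t)) /\
     derivable_pt_lim ws t (- (lam * h t * fe (us t)))) /\
  (forall t theta, 0 < theta -> theta < t -> theta < 1 - t -> theta * mlo <= (1 + C) * us t) /\
  (forall eps, 0 < eps -> exists eta, 0 < eta /\ forall t, 0 < t < 1 -> t < eta -> us t <= eps) /\
  (forall eps, 0 < eps -> exists eta, 0 < eta /\
     forall t, 0 < t < 1 -> 1 - t < eta -> us t <= eps).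
Proof.
  destruct limits_exist as [us [ws [Hlim H0]]].
  pose proof (fun t Ht => proj1 (Hlim t Ht)) as Hu.
  pose proof (fun t Ht => proj2 (Hlim t Ht)) as Hw.
  exists us, ws. split; [exact H0|]. split; [|split; [|split]].
  - intros t Ht. split; [now apply us_bounds|].
    split; [now apply us_derivable | now apply ws_derivable].
  - now apply us_cone.
  - now apply us_vanishes_left.
  - now apply us_vanishes_right.
Qed.

End Limit.

(** * The homeomorphism phi and its inverse *)

(** Composition with this retraction turns continuity relative to the closed unit interval into
    [continuity] on the whole line. *)
Definition clamp (x : R) : R := Rmax 0 (Rmin x 1).

Lemma clamp_unit (x : R) : unit_closed (clamp x).
Proof.
  unfold clamp, unit_closed, Rmax, Rmin.
  destruct (Rle_dec x 1); destruct (Rle_dec 0 _); lra.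
Qed.

Lemma clamp_id (x : R) : unit_closed x -> clamp x = x.
Proof. intros [H0 H1]. unfold clamp. now rewrite Rmin_left, Rmax_right. Qed.

Lemma clamp_dist (x y : R) : Rabs (clamp y - clamp x) <= Rabs (y - x).
Proof.
  unfold clamp, Rmax, Rmin.
  destruct (Rle_dec x 1), (Rle_dec y 1);
    repeat destruct (Rle_dec 0 _); unfold Rabs; repeat destruct (Rcase_abs _); lra.
Qed.

Lemma continuity_clamp (F : R -> R) : cont_on unit_closed F -> continuity (fun x => F (clamp x)).
Proof.
  intros HF x. apply continuity_of_eps. intros eps He.
  destruct (HF (clamp x) (clamp_unit x) eps He) as [eta [Heta H]].
  exists eta. split; [exact Heta|]. intros s Hs. apply H; [apply clamp_unit|].
  exact (Rle_lt_trans _ _ _ (clamp_dist x s) Hs).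
Qed.

Lemma continuity_positive_part (F : R -> R) :
  cont_on nonneg_half_line F -> continuity (fun x => F (Rmax 0 x)).
Proof.
  intros HF x. apply continuity_of_eps. intros eps He.
  destruct (HF (Rmax 0 x) (Rmax_l 0 x) eps He) as [eta [Heta H]].
  exists eta. split; [exact Heta|]. intros s Hs. apply H; [apply Rmax_l|].
  apply Rle_lt_trans with (2 := Hs). unfold Rmax.
  destruct (Rle_dec 0 s), (Rle_dec 0 x); unfold Rabs; repeat destruct (Rcase_abs _); lra.
Qed.

Lemma positive_bounds (F : R -> R) : cont_on unit_closed F -> (forall t, 0 <= t <= 1 -> 0 < F t) ->
  exists lo hi, 0 < lo /\ forall t, lo <= F (clamp t) <= hi.
Proof.
  intros HF Hpos. pose proof (continuity_clamp F HF) as Hc.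
  destruct (continuity_ab_min _ 0 1 Rle_0_1 (fun t _ => Hc t)) as [x [Hx _]].
  destruct (continuity_ab_maj _ 0 1 Rle_0_1 (fun t _ => Hc t)) as [y [Hy _]].
  exists (F (clamp x)), (F (clamp y)). split; [apply Hpos, clamp_unit|]. intros t.
  specialize (Hx (clamp t) (clamp_unit t)). specialize (Hy (clamp t) (clamp_unit t)).
  rewrite (clamp_id (clamp t)) in * by apply clamp_unit. lra.
Qed.

Lemma continuity_pt_interior (F : R -> R) (t : R) :
  cont_on unit_open F -> 0 < t < 1 -> continuity_pt F t.
Proof.
  intros HF Ht. apply continuity_of_eps. intros eps He.
  destruct (HF t Ht eps He) as [eta [Heta H]].
  exists (Rmin eta (Rmin t (1 - t))). split; [repeat apply Rmin_glb_lt; lra|].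
  intros s Hs. pose proof (Rmin_l eta (Rmin t (1 - t))). pose proof (Rmin_r eta (Rmin t (1 - t))).
  pose proof (Rmin_l t (1 - t)). pose proof (Rmin_r t (1 - t)).
  apply H; [|lra]. apply Rabs_def2 in Hs. unfold unit_open. lra.
Qed.

Lemma RInt_is_RInt (F : R -> R) (a b I : R) : RInt_is F a b I -> ex_RInt F a b /\ RInt F a b = I.
Proof.
  intros [pr HI]. split; [now apply ex_RInt_Reals_1 | now rewrite <- HI, (RInt_Reals F a b pr)].
Qed.

Lemma RInt_ge_const (F : R -> R) (x y lo : R) : x <= y -> ex_RInt F x y ->
  (forall z, x < z < y -> lo <= F z) -> lo * (y - x) <= RInt F x y.
Proof.
  intros Hxy HF H. replace (lo * (y - x)) with (RInt (fun _ => lo) x y).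
  - apply RInt_le; auto. apply ex_RInt_const.
  - rewrite RInt_const. unfold scal; simpl; unfold mult; simpl. ring.
Qed.

Lemma RInt_le_const (F : R -> R) (x y hi : R) : x <= y -> ex_RInt F x y ->
  (forall z, x < z < y -> F z <= hi) -> RInt F x y <= hi * (y - x).
Proof.
  intros Hxy HF H. replace (hi * (y - x)) with (RInt (fun _ => hi) x y).
  - apply RInt_le; auto. apply ex_RInt_const.
  - rewrite RInt_const. unfold scal; simpl; unfold mult; simpl. ring.
Qed.

(** [J x] stands for the integral of [Kf] from [x] to [1/2]. With [S] its supremum, [E = S - J] is
    the improper integral from 0 to [x], and it tends to 0 because [S] is a least upper bound. *)
Lemma tail_majorant_exists (Kf J : R -> R) (M : R) :
  (forall x, 0 < x <= 1/2 -> 0 <= Kf x) ->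
  (forall x y, 0 < x <= y -> y <= 1/2 -> Kf y * (y - x) <= J x - J y) ->
  (forall x, 0 < x <= 1/2 -> 0 <= J x <= M) ->
  exists E B, 0 <= B /\ tail_majorant Kf E B /\
    forall eps, 0 < eps -> exists eta, 0 < eta <= 1/2 /\ E eta < eps.
Proof.
  intros HK Hstep HJ.
  destruct (completeness (fun y => exists x, 0 < x <= 1/2 /\ y = J x)) as [S [HS1 HS2]].
  - exists M. intros y [x [Hx ->]]. now apply HJ.
  - exists (J (1/2)), (1/2). split; [lra | reflexivity].
  - assert (HJS : forall x, 0 < x <= 1/2 -> J x <= S) by (intros x Hx; apply HS1; now exists x).
    exists (fun x => S - J x), S. repeat split.
    + apply Rle_trans with (J (1/2)); [apply HJ | apply HJS]; lra.
    + intros x y Hx Hy. specialize (Hstep x y Hx Hy). lra.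
    + specialize (HJS x H). lra.
    + now apply HK.
    + intros x Hx. specialize (HJ x Hx). lra.
    + intros eps He. apply NNPP. intros Hn. assert (S <= S - eps); [|lra].
      apply HS2. intros y [x [Hx ->]]. apply Rnot_lt_le. intros Hlt. apply Hn.
      exists x. split; [exact Hx | lra].
Qed.

Lemma tail_majorant_weaken (Kf E : R -> R) (B B' : R) :
  B <= B' -> tail_majorant Kf E B -> tail_majorant Kf E B'.
Proof.
  intros HB [H1 H2 H3]. constructor; auto. intros x Hx. specialize (H3 x Hx). lra.
Qed.

Section Homeomorphism.

Variables phi psi1 : R -> R.
Hypothesis phi_lt : forall x y, x < y -> phi x < phi y.
Hypothesis phi_odd : forall x, phi (- x) = - phi x.
Hypothesis psi1_homeo : incr_homeo_nonneg psi1.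
Hypothesis phi_psi1 : forall x y, 0 <= x -> 0 <= y -> phi x * psi1 y <= phi (x * y).
Variable pinv : R -> R.
Hypothesis phi_pinv : forall y, phi (pinv y) = y.

Lemma phi_le_inv (x y : R) : phi x <= phi y -> x <= y.
Proof. intros H. apply Rnot_lt_le. intros Hlt. apply phi_lt in Hlt. lra. Qed.

Lemma phi_le (x y : R) : x <= y -> phi x <= phi y.
Proof. intros [H | ->]; [left; now apply phi_lt | right; reflexivity]. Qed.

Lemma phi_0 : phi 0 = 0.
Proof. pose proof (phi_odd 0) as H. rewrite Ropp_0 in H. lra. Qed.

Lemma phi_pos (x : R) : 0 < x -> 0 < phi x.
Proof. intros H. rewrite <- phi_0. now apply phi_lt. Qed.

Lemma pinv_lt (x y : R) : x < y -> pinv x < pinv y.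
Proof.
  intros H. apply Rnot_le_lt. intros Hle. apply phi_le in Hle. rewrite !phi_pinv in Hle. lra.
Qed.

Lemma pinv_le (x y : R) : x <= y -> pinv x <= pinv y.
Proof. intros H. apply phi_le_inv. now rewrite !phi_pinv. Qed.

Lemma pinv_phi (x : R) : pinv (phi x) = x.
Proof. apply Rle_antisym; apply phi_le_inv; rewrite phi_pinv; lra. Qed.

Lemma pinv_odd (y : R) : pinv (- y) = - pinv y.
Proof. apply Rle_antisym; apply phi_le_inv; rewrite phi_odd, !phi_pinv; lra. Qed.

Lemma pinv_0 : pinv 0 = 0.
Proof. rewrite <- phi_0 at 1. apply pinv_phi. Qed.

Lemma pinv_nonneg (y : R) : 0 <= y -> 0 <= pinv y.
Proof. intros H. rewrite <- pinv_0. now apply pinv_le. Qed.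

Lemma pinv_continuity : continuity pinv.
Proof.
  intros y. apply continuity_of_eps. intros eps He.
  assert (H1 : phi (pinv y - eps) < y) by (rewrite <- (phi_pinv y) at 2; apply phi_lt; lra).
  assert (H2 : y < phi (pinv y + eps)) by (rewrite <- (phi_pinv y) at 1; apply phi_lt; lra).
  exists (Rmin (y - phi (pinv y - eps)) (phi (pinv y + eps) - y)).
  split; [apply Rmin_glb_lt; lra|]. intros s Hs.
  pose proof (Rmin_l (y - phi (pinv y - eps)) (phi (pinv y + eps) - y)).
  pose proof (Rmin_r (y - phi (pinv y - eps)) (phi (pinv y + eps) - y)).
  apply Rabs_def2 in Hs.
  assert (H3 : pinv (phi (pinv y - eps)) < pinv s) by (apply pinv_lt; lra).
  assert (H4 : pinv s < pinv (phi (pinv y + eps))) by (apply pinv_lt; lra).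
  rewrite pinv_phi in H3, H4. apply Rabs_def1; lra.
Qed.

(** The form in which condition (A) acts on slopes: the inverse of [phi] turns a factor [psi1 k] of
    the flux into a factor [k]. *)
Lemma pinv_mul_le (x k y : R) : 0 <= x -> 0 <= k -> y <= phi x * psi1 k -> pinv y <= x * k.
Proof.
  intros Hx Hk Hy. apply phi_le_inv. rewrite phi_pinv.
  apply Rle_trans with (1 := Hy). now apply phi_psi1.
Qed.

Lemma psi1_pos (y : R) : 0 < y -> 0 < psi1 y.
Proof.
  destruct psi1_homeo as [_ [Hlt [Hnn _]]]. intros Hy.
  apply Rle_lt_trans with (psi1 0); [apply Hnn; lra | apply Hlt; lra].
Qed.

Lemma psi1_le_inv (x y : R) : 0 <= y -> psi1 x <= psi1 y -> x <= y.
Proof.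
  destruct psi1_homeo as [_ [Hlt _]]. intros Hy H. apply Rnot_lt_le. intros Hxy.
  specialize (Hlt y x Hy Hxy). lra.
Qed.

Variables (c0 c1 d0 d1 : R).
Hypothesis c0_pos : 0 < c0.
Hypothesis c01 : c0 <= c1.
Hypothesis d0_pos : 0 < d0.
Hypothesis d01 : d0 <= d1.

Definition slope_lo (w : R) : R := pinv (w / d1) / c1.
Definition slope_hi (w : R) : R := pinv (w / d0) / c0.

Lemma slope_gauges : exists C, gauges slope_lo slope_hi C.
Proof.
  destruct psi1_homeo as [_ [_ [_ Hsurj]]].
  (* With [x = pinv (w / d1)], the flux [w / d0] equals [phi x * psi1 z], so its inverse image is at
     most [x * z]. *)
  destruct (Hsurj (d1 / d0)) as [z [Hz Hpsi]]; [apply Rdiv_le_0_compat; lra|].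
  assert (Hk : 0 <= z * c1 / c0) by (apply Rdiv_le_0_compat; [apply Rmult_le_pos|]; lra).
  exists (z * c1 / c0 + 1). unfold slope_lo, slope_hi. constructor.
  - unfold Rdiv. now rewrite Rmult_0_l, pinv_0, Rmult_0_l.
  - intros x y Hxy. apply Rmult_lt_compat_r; [apply Rinv_0_lt_compat; lra|].
    apply pinv_lt, Rmult_lt_compat_r; [apply Rinv_0_lt_compat; lra | exact Hxy].
  - unfold Rdiv. now rewrite Rmult_0_l, pinv_0, Rmult_0_l.
  - intros x y Hxy. apply Rmult_le_compat_r; [left; apply Rinv_0_lt_compat; lra|].
    apply pinv_le, Rmult_le_compat_r; [left; apply Rinv_0_lt_compat; lra | exact Hxy].
  - intros w Hw. set (x := pinv (w / d1)).
    assert (Hx : 0 <= x) by (apply pinv_nonneg, Rdiv_le_0_compat; lra).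
    assert (H : pinv (w / d0) <= x * z).
    { apply pinv_mul_le; auto. unfold x. rewrite phi_pinv, Hpsi. right. field. lra. }
    apply Rle_trans with (x * z / c0).
    + apply Rmult_le_compat_r; [left; apply Rinv_0_lt_compat; lra | exact H].
    + replace (x * z / c0) with (z * c1 / c0 * (x / c1)) by (field; lra).
      assert (0 <= x / c1) by (apply Rdiv_le_0_compat; lra). nra.
  - lra.
Qed.

Lemma slope_lo_unbounded (y : R) : exists x, 0 < x /\ y <= slope_lo x.
Proof.
  pose proof (Rle_abs y). pose proof (Rabs_pos y).
  exists (d1 * phi (c1 * (Rabs y + 1))). split.
  - apply Rmult_lt_0_compat; [lra|]. apply phi_pos, Rmult_lt_0_compat; lra.
  - unfold slope_lo.
    replace (d1 * phi (c1 * (Rabs y + 1)) / d1) with (phi (c1 * (Rabs y + 1))) by (field; lra).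
    rewrite pinv_phi. replace (c1 * (Rabs y + 1) / c1) with (Rabs y + 1) by (field; lra). lra.
Qed.

Lemma slope_response (c d : R) : c0 <= c <= c1 -> d0 <= d <= d1 ->
  response slope_lo slope_hi (fun w => pinv (w / d) / c).
Proof.
  intros Hc Hd. split.
  - intros w. replace (- w / d) with (- (w / d)) by (field; lra). rewrite pinv_odd. field. lra.
  - intros w Hw. unfold slope_lo, slope_hi, Rdiv.
    assert (Hi : forall x y, 0 < x -> x <= y -> 0 < / y <= / x).
    { intros x y Hx Hxy. split; [apply Rinv_0_lt_compat; lra | now apply Rinv_le_contravar]. }
    destruct (Hi c0 c) as [HI1 HI2]; try lra. destruct (Hi c c1) as [HI3 HI4]; try lra.
    destruct (Hi d0 d) as [HI5 HI6]; try lra. destruct (Hi d d1) as [HI7 HI8]; try lra.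
    assert (0 <= w * / d1) by (apply Rmult_le_pos; lra).
    assert (0 <= w * / d) by (apply Rmult_le_pos; lra).
    split; apply Rmult_le_compat; try lra; try (now apply pinv_nonneg);
      apply pinv_le, Rmult_le_compat_l; lra.
Qed.

(** A sum is at most twice its larger term: either [2 * P] gives a constant, or [2 * F * psi1 k]
    gives a slope linear in [k]. *)
Lemma slope_hi_affine (P F : R) : 0 <= P -> 0 <= F -> exists C1 Q, 0 <= C1 /\ 0 <= Q /\
  forall k, 0 <= k -> slope_hi (P + F * psi1 k) <= C1 + Q * k.
Proof.
  intros HP HF. set (X := pinv (2 * F / d0)).
  assert (HX : 0 <= X) by (apply pinv_nonneg, Rdiv_le_0_compat; lra).
  assert (Hc : 0 < / c0) by now apply Rinv_0_lt_compat.
  assert (Hd : 0 < / d0) by now apply Rinv_0_lt_compat.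
  assert (HP0 : 0 <= slope_hi (2 * P)).
  { apply Rmult_le_pos; [|lra]. apply pinv_nonneg, Rmult_le_pos; lra. }
  exists (slope_hi (2 * P)), (X / c0). repeat split; [exact HP0 | apply Rmult_le_pos; lra |].
  intros k Hk.
  assert (HF2 : slope_hi (2 * (F * psi1 k)) <= X / c0 * k).
  { unfold slope_hi. replace (X / c0 * k) with (X * k / c0) by (field; lra).
    apply Rmult_le_compat_r; [lra|]. apply pinv_mul_le; auto.
    unfold X. rewrite phi_pinv. right. field. lra. }
  assert (Hmono : forall x y, x <= y -> slope_hi x <= slope_hi y).
  { intros x y Hxy. apply Rmult_le_compat_r; [lra|]. apply pinv_le, Rmult_le_compat_r; lra. }
  assert (HXk : 0 <= X / c0 * k) by (repeat apply Rmult_le_pos; lra).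
  destruct (Rle_dec P (F * psi1 k)) as [Hle|Hgt].
  - pose proof (Hmono (P + F * psi1 k) (2 * (F * psi1 k)) ltac:(lra)). lra.
  - pose proof (Hmono (P + F * psi1 k) (2 * P) ltac:(lra)). lra.
Qed.

(** Condition (A) is applied twice, to [phi M * psi1 y] and then to the factor [psi1 k]. The bound
    is proportional to [M], so a small [y] yields a run lower than its own assumed height [M]. *)
Lemma slope_hi_product (M y k : R) : 0 < M -> 0 <= y -> 0 <= k ->
  slope_hi (d0 * (phi M * psi1 y) * psi1 k) <= M * y / c0 * k.
Proof.
  intros HM Hy Hk. unfold slope_hi. replace (M * y / c0 * k) with (M * y * k / c0) by (field; lra).
  apply Rmult_le_compat_r; [left; now apply Rinv_0_lt_compat|].
  apply pinv_mul_le; [apply Rmult_le_pos; lra | exact Hk |].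
  replace (d0 * (phi M * psi1 y) * psi1 k / d0) with (phi M * psi1 y * psi1 k) by (field; lra).
  apply Rmult_le_compat_r; [apply psi1_homeo, Hk | apply phi_psi1; lra].
Qed.

End Homeomorphism.

(** * The boundary value problem *)

Section Primitive.

Variable h : R -> R.
Hypothesis h_cont : cont_on unit_open h.
Hypothesis h_nonneg : forall t, 0 < t < 1 -> 0 <= h t.

(** Based at [1/2] because [h] need not be integrable at either end. *)
Definition primitive (t : R) : R := RInt h (1/2) t.

Lemma h_ex_RInt (a b : R) : 0 < a < 1 -> 0 < b < 1 -> ex_RInt h a b.
Proof.
  intros Ha Hb. apply (ex_RInt_continuous (V := R_CompleteNormedModule)). intros z Hz.
  apply continuity_pt_filterlim, continuity_pt_interior; [exact h_cont|].
  pose proof (Rmin_glb_lt a b 0 ltac:(lra) ltac:(lra)).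
  pose proof (Rmax_lub_lt a b 1 ltac:(lra) ltac:(lra)). lra.
Qed.

Lemma primitive_minus (x y : R) : 0 < x < 1 -> 0 < y < 1 ->
  primitive y - primitive x = RInt h x y.
Proof.
  intros Hx Hy. unfold primitive.
  rewrite <- (RInt_Chasles h (1/2) x y) by (apply h_ex_RInt; lra).
  unfold plus; simpl. ring.
Qed.

Lemma primitive_le (x y : R) : 0 < x -> x <= y -> y < 1 -> primitive x <= primitive y.
Proof.
  intros Hx Hxy Hy. pose proof (primitive_minus x y ltac:(lra) ltac:(lra)) as H.
  pose proof (RInt_ge_const h x y 0 Hxy ltac:(apply h_ex_RInt; lra)
    ltac:(intros; apply h_nonneg; lra)). lra.
Qed.

Lemma primitive_deriv (t : R) : 0 < t < 1 -> forall eps, 0 < eps -> exists eta, 0 < eta /\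
  forall x y, t - eta < x -> x <= y -> y < t + eta ->
  (h t - eps) * (y - x) <= primitive y - primitive x <= (h t + eps) * (y - x).
Proof.
  intros Ht eps He.
  destruct (continuity_pt_eps h t (continuity_pt_interior h t h_cont Ht) eps He) as [r [Hr H]].
  exists (Rmin r (Rmin t (1 - t))). split; [repeat apply Rmin_glb_lt; lra|].
  pose proof (Rmin_l r (Rmin t (1 - t))). pose proof (Rmin_r r (Rmin t (1 - t))).
  pose proof (Rmin_l t (1 - t)). pose proof (Rmin_r t (1 - t)).
  intros x y Hx Hxy Hy. rewrite primitive_minus by lra.
  assert (Hz : forall z, x < z < y -> h t - eps <= h z <= h t + eps).
  { intros z Hz. assert (Hd : Rabs (h z - h t) < eps) by (apply H, Rabs_def1; lra).
    apply Rabs_def2 in Hd. lra. }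
  split; [apply RInt_ge_const | apply RInt_le_const]; auto;
    try (apply h_ex_RInt; lra); intros z Hz'; now apply Hz.
Qed.

Lemma primitive_continuity_pt (t : R) : 0 < t < 1 -> continuity_pt primitive t.
Proof.
  intros Ht. apply derivable_continuous_pt. exists (h t).
  apply derivable_pt_lim_squeeze, primitive_deriv, Ht.
Qed.

Lemma primitive_increases : (exists t, 0 < t < 1 /\ h t <> 0) ->
  exists x y, 0 < x /\ x < y /\ y < 1 /\ primitive x < primitive y.
Proof.
  intros [t [Ht Hne]]. pose proof (h_nonneg t Ht).
  destruct (primitive_deriv t Ht (h t / 2) ltac:(lra)) as [eta [Heta H1]].
  set (r := Rmin eta (Rmin t (1 - t)) / 2).
  assert (Hr : 0 < r /\ r < eta /\ r < t /\ r < 1 - t).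
  { unfold r. pose proof (Rmin_l eta (Rmin t (1 - t))). pose proof (Rmin_r eta (Rmin t (1 - t))).
    pose proof (Rmin_l t (1 - t)). pose proof (Rmin_r t (1 - t)).
    assert (0 < Rmin eta (Rmin t (1 - t))) by (repeat apply Rmin_glb_lt; lra). lra. }
  exists (t - r), (t + r). repeat split; try lra.
  destruct (H1 (t - r) (t + r) ltac:(lra) ltac:(lra) ltac:(lra)) as [H2 _].
  assert (0 < (h t - h t / 2) * (t + r - (t - r))) by (apply Rmult_lt_0_compat; lra). lra.
Qed.

(** The right integrand is reflected so that both singularities sit at 0. Each integrand is monotone
    towards its singular end, since [psi1] increases and the integral of [h] grows; this gives the
    step inequality. Each truncated integral is bounded because the other one is nonnegative. *)
Lemma tail_majorants_of_integrability (psi1 : R -> R) :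
  incr_homeo_nonneg psi1 -> h_integrability psi1 h ->
  exists KL EL KR ER B,
    tail_majorant KL EL B /\ tail_majorant KR ER B /\
    (forall eps, 0 < eps -> exists eta, 0 < eta <= 1/2 /\ EL eta < eps) /\
    (forall eps, 0 < eps -> exists eta, 0 < eta <= 1/2 /\ ER eta < eps) /\
    (forall x, 0 < x <= 1/2 -> psi1 (KL x) = primitive (1/2) - primitive x) /\
    (forall x, 0 < x <= 1/2 -> psi1 (KR x) = primitive (1 - x) - primitive (1/2)) /\ 0 <= B.
Proof.
  intros Hpsi [K1 [K2 [HK1 [HK2 [M HM]]]]].
  assert (H1 : forall x, 0 < x <= 1/2 ->
            0 <= K1 x /\ psi1 (K1 x) = primitive (1/2) - primitive x).
  { intros x Hx. destruct (HK1 x Hx) as [I [HI [Hnn Heq]]]. apply RInt_is_RInt in HI.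
    rewrite primitive_minus by lra. split; [exact Hnn|]. rewrite Heq. symmetry. apply HI. }
  assert (H2 : forall x, 0 < x <= 1/2 ->
            0 <= K2 (1 - x) /\ psi1 (K2 (1 - x)) = primitive (1 - x) - primitive (1/2)).
  { intros x Hx. destruct (HK2 (1 - x) ltac:(lra)) as [I [HI [Hnn Heq]]].
    apply RInt_is_RInt in HI.
    rewrite primitive_minus by lra. split; [exact Hnn|]. rewrite Heq. symmetry. apply HI. }
  assert (HI1 : forall x, 0 < x <= 1/2 -> ex_RInt K1 x (1/2)).
  { intros x Hx. destruct (HM x Hx) as [I1 [I2 [HI _]]]. now apply RInt_is_RInt in HI. }
  assert (HI2 : forall x, 0 < x <= 1/2 -> ex_RInt K2 (1/2) (1 - x)).
  { intros x Hx. destruct (HM x Hx) as [I1 [I2 [_ [HI _]]]]. now apply RInt_is_RInt in HI. }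
  assert (HMs : forall x, 0 < x <= 1/2 -> RInt K1 x (1/2) + RInt K2 (1/2) (1 - x) <= M).
  { intros x Hx. destruct (HM x Hx) as [I1 [I2 [HA [HB Hle]]]].
    apply RInt_is_RInt in HA, HB. destruct HA as [_ ->], HB as [_ ->]. exact Hle. }
  assert (Hpos1 : forall x, 0 < x <= 1/2 -> 0 <= RInt K1 x (1/2)).
  { intros x Hx. pose proof (RInt_ge_const K1 x (1/2) 0 ltac:(lra) (HI1 x Hx)
      ltac:(intros; apply H1; lra)). lra. }
  assert (Hpos2 : forall x, 0 < x <= 1/2 -> 0 <= RInt K2 (1/2) (1 - x)).
  { intros x Hx. pose proof (RInt_ge_const K2 (1/2) (1 - x) 0 ltac:(lra) (HI2 x Hx)) as H.
    rewrite Rmult_0_l in H. apply H. intros z Hz.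
    replace z with (1 - (1 - z)) by ring. apply H2. lra. }
  destruct (tail_majorant_exists K1 (fun x => RInt K1 x (1/2)) M) as [EL [BL [HBL [HtL HEL]]]].
  { intros x Hx. now apply H1. }
  { intros x y Hx Hy.
    assert (Hex : ex_RInt K1 x y)
      by (apply (ex_RInt_Chasles_1 K1 x y (1/2)); [lra | apply HI1; lra]).
    rewrite <- (RInt_Chasles K1 x y (1/2) Hex (HI1 y ltac:(lra))). unfold plus; simpl.
    pose proof (RInt_ge_const K1 x y (K1 y) ltac:(lra) Hex) as H.
    assert (K1 y * (y - x) <= RInt K1 x y); [|lra]. apply H. intros z Hz.
    destruct (H1 z ltac:(lra)) as [Hz0 Hz1]. destruct (H1 y ltac:(lra)) as [_ Hy1].
    apply (psi1_le_inv psi1 Hpsi); [exact Hz0|]. rewrite Hz1, Hy1.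
    pose proof (primitive_le z y ltac:(lra) ltac:(lra) ltac:(lra)). lra. }
  { intros x Hx. pose proof (HMs x Hx). pose proof (Hpos1 x Hx). pose proof (Hpos2 x Hx). lra. }
  destruct (tail_majorant_exists (fun x => K2 (1 - x)) (fun x => RInt K2 (1/2) (1 - x)) M)
    as [ER [BR [HBR [HtR HER]]]].
  { intros x Hx. now apply H2. }
  { intros x y Hx Hy.
    assert (Hex : ex_RInt K2 (1 - y) (1 - x))
      by (apply (ex_RInt_Chasles_2 K2 (1/2) (1 - y) (1 - x)); [lra | apply HI2; lra]).
    rewrite <- (RInt_Chasles K2 (1/2) (1 - y) (1 - x) (HI2 y ltac:(lra)) Hex). unfold plus; simpl.
    pose proof (RInt_ge_const K2 (1 - y) (1 - x) (K2 (1 - y)) ltac:(lra) Hex) as H.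
    assert (K2 (1 - y) * (1 - x - (1 - y)) <= RInt K2 (1 - y) (1 - x)).
    { apply H. intros z Hz.
      destruct (H2 (1 - z) ltac:(lra)) as [Hz0 Hz1]. destruct (H2 y ltac:(lra)) as [_ Hy1].
      replace (1 - (1 - z)) with z in * by ring.
      apply (psi1_le_inv psi1 Hpsi); [exact Hz0|]. rewrite Hz1, Hy1.
      pose proof (primitive_le (1 - y) z ltac:(lra) ltac:(lra) ltac:(lra)). lra. }
    replace (y - x) with (1 - x - (1 - y)) by ring. lra. }
  { intros x Hx. pose proof (HMs x Hx). pose proof (Hpos1 x Hx). pose proof (Hpos2 x Hx). lra. }
  exists K1, EL, (fun x => K2 (1 - x)), ER, (BL + BR).
  split; [apply (tail_majorant_weaken _ _ BL); [lra | exact HtL]|].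
  split; [apply (tail_majorant_weaken _ _ BR); [lra | exact HtR]|].
  repeat split; auto; try lra; intros x Hx; [now apply H1 | now apply H2].
Qed.

End Primitive.

(** * Height bounds and solutions for a given parameter *)

Section Problem.

Variables phi psi1 c d f h : R -> R.
Hypothesis phi_lt : forall x y, x < y -> phi x < phi y.
Hypothesis phi_odd : forall x, phi (- x) = - phi x.
Hypothesis psi1_homeo : incr_homeo_nonneg psi1.
Hypothesis phi_psi1 : forall x y, 0 <= x -> 0 <= y -> phi x * psi1 y <= phi (x * y).
Variable pinv : R -> R.
Hypothesis phi_pinv : forall y, phi (pinv y) = y.
Hypothesis c_cont : cont_on unit_closed c.
Hypothesis d_cont : cont_on unit_closed d.
Variables (c0 c1 d0 d1 : R).
Hypothesis c0_pos : 0 < c0.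
Hypothesis d0_pos : 0 < d0.
Hypothesis c_bounds : forall t, c0 <= c (clamp t) <= c1.
Hypothesis d_bounds : forall t, d0 <= d (clamp t) <= d1.
Hypothesis f_cont : cont_on nonneg_half_line f.
Hypothesis f_nonneg : forall s, 0 <= s -> 0 <= f s.
Hypothesis f_pos : forall s, 0 < s -> 0 < f s.
Hypothesis h_cont : cont_on unit_open h.
Hypothesis h_nonneg : forall t, 0 < t < 1 -> 0 <= h t.
Hypothesis h_nonzero : exists t, 0 < t < 1 /\ h t <> 0.
Hypothesis h_int : h_integrability psi1 h.
Hypothesis f_0 : forall eps, 0 < eps -> exists delta, 0 < delta /\
  forall s, 0 < s < delta -> Rabs (f s / phi s) < eps.
Hypothesis f_inf : forall eps, 0 < eps -> exists M, forall s, M < s -> Rabs (f s / phi s) < eps.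

(** Runs may overshoot below zero, so [f] is continued by [f 0], which turns out to vanish. *)
Let fe (s : R) : R := f (Rmax 0 s).
Let A : R -> R := primitive h.
Let G (t w : R) : R := pinv (w / d (clamp t)) / c (clamp t).
Let glo : R -> R := slope_lo pinv c1 d1.
Let ghi : R -> R := slope_hi pinv c0 d0.
Let grid (n : nat) : nat := (2 * n + 1)%nat.
Let scheme (n : nat) (lam : R) (u w : nat -> R) : Prop :=
  shooting_scheme (grid n) (fun i => A (midpoint (grid n) i)) (fun i => G (midpoint (grid n) i))
    lam fe u w.

Lemma c01 : c0 <= c1.
Proof. pose proof (c_bounds 0). lra. Qed.

Lemma d01 : d0 <= d1.
Proof. pose proof (d_bounds 0). lra. Qed.

Lemma problem_gauges : exists C, gauges glo ghi C.
Proof.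
  exact (slope_gauges phi psi1 phi_lt phi_odd psi1_homeo phi_psi1 pinv phi_pinv c0 c1 d0 d1
    c0_pos c01 d0_pos d01).
Qed.

Lemma problem_glo_unbounded (y : R) : exists x, 0 < x /\ y <= glo x.
Proof.
  exact (slope_lo_unbounded phi phi_lt phi_odd pinv phi_pinv c0 c1 d0 d1
    c0_pos c01 d0_pos d01 y).
Qed.

Lemma ratio_small (s eps : R) : 0 < s -> Rabs (f s / phi s) < eps -> f s <= eps * phi s.
Proof.
  intros Hs H. assert (Hp : 0 < phi s) by (apply (phi_pos phi); auto).
  apply Rabs_def2 in H. apply Rmult_le_reg_r with (/ phi s); [now apply Rinv_0_lt_compat|].
  replace (eps * phi s * / phi s) with eps by (field; lra). unfold Rdiv in H. lra.
Qed.

Lemma fe_nonneg (s : R) : 0 <= fe s.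
Proof. apply f_nonneg, Rmax_l. Qed.

Lemma fe_continuity : continuity fe.
Proof. exact (continuity_positive_part f f_cont). Qed.

Lemma fe_id (s : R) : 0 <= s -> fe s = f s.
Proof. intros Hs. unfold fe. now rewrite Rmax_right. Qed.

(** Otherwise continuity would keep [f] above [f 0 / 2] near 0, whereas [f s <= phi s <= f 0 / 4]
    for small [s]; [q] below is the point where [phi] equals [f 0 / 4]. *)
Lemma f_at_0 : f 0 = 0.
Proof.
  destruct (f_nonneg 0 ltac:(lra)) as [Hpos|H]; [|now symmetry].
  destruct (f_0 1 ltac:(lra)) as [delta [Hd Hr]].
  destruct (f_cont 0 ltac:(unfold nonneg_half_line; lra) (f 0 / 2) ltac:(lra)) as [eta [Heta He]].
  set (q := pinv (f 0 / 4)).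
  assert (Hq : 0 < q).
  { apply Rle_lt_trans with (pinv 0).
    - right. symmetry. now apply (pinv_0 phi).
    - now apply (pinv_lt phi); [| |lra]. }
  set (s := Rmin q (Rmin (delta / 2) (eta / 2))).
  assert (Hs : 0 < s) by (repeat apply Rmin_glb_lt; lra).
  assert (Hsq : s <= q) by apply Rmin_l.
  assert (Hs2 : s <= delta / 2 /\ s <= eta / 2).
  { split; apply Rle_trans with (1 := Rmin_r _ _); [apply Rmin_l | apply Rmin_r]. }
  pose proof (ratio_small s 1 Hs (Hr s ltac:(lra))) as H1.
  assert (H2 : Rabs (f s - f 0) < f 0 / 2).
  { apply He; [unfold nonneg_half_line; lra | apply Rabs_def1; lra]. }
  apply Rabs_def2 in H2. apply (phi_le phi phi_lt) in Hsq. unfold q in Hsq.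
  rewrite phi_pinv in Hsq. lra.
Qed.

Lemma fe_at_0 : fe 0 = 0.
Proof. rewrite fe_id by lra. exact f_at_0. Qed.

Lemma G_response (t : R) : response glo ghi (G t).
Proof. apply (slope_response phi); auto. Qed.

Lemma G_joint_continuity (t w eps : R) : 0 < eps -> exists eta, 0 < eta /\
  forall s v, Rabs (s - t) < eta -> Rabs (v - w) < eta -> Rabs (G s v - G t w) < eps.
Proof.
  intros He. assert (H : continuity_2d_pt G t w).
  { assert (Hcoef : forall F, cont_on unit_closed F ->
              continuity_2d_pt (fun s _ => F (clamp s)) t w).
    { intros F HF.
      apply (continuity_1d_2d_pt_comp (fun s => F (clamp s)) (fun s _ => s)).
      - apply continuity_clamp, HF.
      - apply continuity_2d_pt_id1. }
    assert (Hcne : c (clamp t) <> 0) by (pose proof (c_bounds t); lra).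
    assert (Hdne : d (clamp t) <> 0) by (pose proof (d_bounds t); lra).
    unfold G, Rdiv. apply continuity_2d_pt_mult.
    - apply (continuity_1d_2d_pt_comp pinv (fun s v => v * / d (clamp s))).
      + apply (pinv_continuity phi); auto.
      + apply continuity_2d_pt_mult; [apply continuity_2d_pt_id2|].
        apply continuity_2d_pt_inv; auto.
    - apply continuity_2d_pt_inv; auto. }
  destruct (H (mkposreal eps He)) as [eta Heta]. exists eta. split; [apply eta|].
  intros s v Hs Hv. now apply Heta.
Qed.

Lemma G_continuity (t : R) : continuity (G t).
Proof.
  intros w. apply continuity_of_eps. intros eps He.
  destruct (G_joint_continuity t w eps He) as [eta [Heta H]].
  exists eta. split; [exact Heta|]. intros s Hs. apply H; [|exact Hs].
  now rewrite Rminus_diag, Rabs_R0.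
Qed.

Lemma grid_pos (n : nat) : (0 < grid n)%nat.
Proof. unfold grid. lia. Qed.

Lemma grid_admissible (n : nat) :
  admissible glo ghi (grid n) (fun i => A (midpoint (grid n) i)) (fun i => G (midpoint (grid n) i)).
Proof.
  exact (admissible_grid glo ghi G (fun t _ => G_response t) A (primitive_le h h_cont h_nonneg)
    (fun n => n) n).
Qed.

Lemma landing_bounds (lam : R) : 0 < lam -> exists m0 m1, 0 < m0 /\
  forall n u w k, scheme n lam u w -> u O = 0 -> u (grid n) <= 0 ->
    argmax_upto u (grid n) k -> 0 < u k -> m0 <= u k <= m1.
Proof.
  intros Hlam.
  destruct (tail_majorants_of_integrability h h_cont h_nonneg psi1 psi1_homeo h_int)
    as [KL [EL [KR [ER [B [HtL [HtR [_ [_ [HKL [HKR HB]]]]]]]]]]].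
  destruct problem_gauges as [C Hg].
  (* Chosen so that [2 * (y0 / c0) * B = B / (2 * (B + 1)) < 1]; [kappa] is then determined by
     [lam * kappa = d0 * psi1 y0], the shape required by [slope_hi_product]. *)
  set (y0 := c0 / (4 * (B + 1))).
  assert (Hy0 : 0 < y0) by (apply Rdiv_lt_0_compat; lra).
  set (kappa := psi1 y0 * d0 / lam).
  assert (Hkap : 0 < kappa).
  { apply Rdiv_lt_0_compat; [|lra]. apply Rmult_lt_0_compat; [|lra]. now apply psi1_pos. }
  (* [fe <= kappa * phi (u k)] would make the height [u k] at most
     [2 * (u k * y0 / c0) * B < u k]. *)
  assert (Hcore : forall n u w k, scheme n lam u w -> u O = 0 -> u (grid n) <= 0 ->
    argmax_upto u (grid n) k -> 0 < u k ->
    ~ (forall s, s <= u k -> fe s <= kappa * phi (u k))).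
  { intros n u w k Hrun H0 HN0 [Hk Hmax] Hpos HF.
    assert (Hprod : forall x, 0 <= x ->
       ghi (lam * (kappa * phi (u k)) * psi1 x) <= u k * y0 / c0 * x).
    { intros x Hx. replace (lam * (kappa * phi (u k)) * psi1 x)
        with (d0 * (phi (u k) * psi1 y0) * psi1 x) by (unfold kappa; field; lra).
      apply (slope_hi_product phi psi1); auto. lra. }
    assert (HQ : 0 <= u k * y0 / c0) by (apply Rdiv_le_0_compat; [apply Rmult_le_pos|]; lra).
    assert (H : u k <= 2 * (u k * y0 / c0) * B).
    { apply (height_upper_bound glo ghi C Hg (grid n) (grid_pos n) fe fe_nonneg lam Hlam
        _ _ u w n k KL EL KR ER B (u k * y0 / c0) (kappa * phi (u k)) (grid_admissible n) Hrun
        HtL HtR HQ); auto; try lra.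
      - intros i Hi. pose proof (midpoint_range (grid n) (grid_pos n) n i eq_refl Hi) as Hm.
        pose proof (midpoint_center (fun n => n) n) as Hc. cbv beta in Hc.
        fold (grid n) in Hc. rewrite Hc. unfold midpoint, A. rewrite <- HKL by exact Hm.
        apply Hprod, (tail_pos _ _ _ HtL), Hm.
      - intros i Hi. pose proof (midpoint_range (grid n) (grid_pos n) n i eq_refl Hi) as Hm.
        pose proof (midpoint_center (fun n => n) n) as Hc. cbv beta in Hc.
        pose proof (midpoint_reflect (fun n => n) n i Hi) as Hr. cbv beta in Hr.
        fold (grid n) in Hc, Hr. rewrite Hc, Hr. unfold midpoint, A. rewrite <- HKR by exact Hm.
        apply Hprod, (tail_pos _ _ _ HtR), Hm. }
    assert (Heq : 2 * (u k * y0 / c0) * B = u k * (B / (2 * (B + 1))))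
      by (unfold y0; field; lra).
    assert (B / (2 * (B + 1)) < 1).
    { apply Rmult_lt_reg_r with (2 * (B + 1)); [lra|].
      replace (B / (2 * (B + 1)) * (2 * (B + 1))) with B by (field; lra). lra. }
    nra. }
  destruct (f_0 kappa Hkap) as [delta [Hdel Hf0]].
  destruct (f_inf kappa Hkap) as [M Hfinf].
  pose proof (Rmax_l 0 M) as HM1. pose proof (Rmax_r 0 M) as HM2. set (Mx := Rmax 0 M + 1).
  destruct (continuity_ab_maj fe 0 Mx ltac:(unfold Mx; lra) (fun s _ => fe_continuity s))
    as [sx [Hsx _]].
  (* Smallness of the ratio at infinity says nothing about moderate [s]: up to [Mx] the maximum
     [fe sx] of [fe] is absorbed by [kappa * phi m1], beyond [Mx] the ratio is below [kappa]. *)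
  set (m1 := Rmax Mx (pinv (fe sx / kappa))).
  assert (Hm1 : Mx <= m1) by apply Rmax_l.
  assert (Hneg : forall s x, s <= 0 -> 0 < x -> fe s <= kappa * phi x).
  { intros s x Hs Hx. unfold fe. rewrite Rmax_left by exact Hs. rewrite f_at_0.
    apply Rmult_le_pos; [lra|]. left. now apply (phi_pos phi). }
  exists delta, m1. split; [exact Hdel|].
  intros n u w k Hrun H0 HN0 Hk Hpos. split; apply Rnot_lt_le; intros Hlt;
    apply (Hcore n u w k Hrun H0 HN0 Hk Hpos); intros s Hs;
    destruct (Rle_dec s 0) as [Hs0|Hs0]; try (now apply Hneg).
  - rewrite fe_id by lra. apply Rle_trans with (kappa * phi s).
    + apply ratio_small; [lra | apply Hf0; lra].
    + apply Rmult_le_compat_l; [lra | now apply (phi_le phi)].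
  - destruct (Rle_dec s Mx) as [HsM|HsM].
    + apply Rle_trans with (fe sx); [apply Hsx; lra|].
      apply Rle_trans with (kappa * phi (pinv (fe sx / kappa))).
      * rewrite phi_pinv. right. field. lra.
      * apply Rmult_le_compat_l; [lra|]. apply (phi_le phi); [exact phi_lt|].
        apply Rle_trans with m1; [apply Rmax_r | lra].
    + rewrite fe_id by lra. apply Rle_trans with (kappa * phi s).
      * apply ratio_small; [lra | apply Hfinf; unfold Mx in *; lra].
      * apply Rmult_le_compat_l; [lra | now apply (phi_le phi)].
Qed.

(** At height [m] the cone estimate confines [u], away from the ends, to a compact interval on which
    [fe >= D > 0]. The flux drop across an interval where the primitive grows is then proportional
    to [lam], and for large [lam] it would force a height above [m]. *)
Lemma height_avoided (m : R) : 0 < m -> exists L, 0 < L /\ forall lam, L < lam -> exists n0,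
  forall n u w k, (n0 <= n)%nat -> scheme n lam u w -> u O = 0 -> 0 <= u (grid n) ->
    argmax_upto u (grid n) k -> u k <> m.
Proof.
  intros Hm.
  destruct problem_gauges as [C Hg]. pose proof (gauge_pos _ _ _ Hg) as HC.
  destruct (primitive_increases h h_cont h_nonneg h_nonzero) as [al [be [Hal [Hab [Hbe HA]]]]].
  fold A in HA. set (dA := A be - A al). assert (HdA : 0 < dA) by (unfold dA; lra).
  set (th := Rmin al (1 - be) / 2).
  assert (Hth : 0 < th /\ th <= al / 2 /\ th <= (1 - be) / 2).
  { unfold th. pose proof (Rmin_l al (1 - be)). pose proof (Rmin_r al (1 - be)).
    pose proof (Rmin_glb_lt al (1 - be) 0 ltac:(lra) ltac:(lra)). lra. }
  assert (Hlow : 0 < th * m / (1 + C) <= m).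
  { split; [apply Rdiv_lt_0_compat; [apply Rmult_lt_0_compat|]; lra|].
    apply Rmult_le_reg_r with (1 + C); [lra|].
    replace (th * m / (1 + C) * (1 + C)) with (th * m) by (field; lra). nra. }
  destruct (continuity_ab_min fe (th * m / (1 + C)) m (proj2 Hlow) (fun s _ => fe_continuity s))
    as [sD [HsD HsDr]].
  set (D := fe sD).
  assert (HD : 0 < D) by (unfold D; rewrite fe_id by lra; apply f_pos; lra).
  (* A flux [x0] held at distance [th] from the ends gives height at least [m + 1]; [L] makes half
     the flux drop exceed [x0]. *)
  destruct (problem_glo_unbounded ((m + 1) / th)) as [x0 [Hx0 Hglo]].
  exists (2 * x0 / (D * dA)). assert (HDA : 0 < D * dA) by now apply Rmult_lt_0_compat.
  split; [apply Rdiv_lt_0_compat; lra|]. intros lam Hlam.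
  assert (Hlam0 : 0 < lam)
    by (apply Rlt_trans with (2 := Hlam); apply Rdiv_lt_0_compat; lra).
  destruct (archimed_cor1 th (proj1 Hth)) as [n0 [Hn0 Hn0p]].
  exists n0. intros n u w k Hn Hrun H0 HN0 [Hk Hmax] Hum.
  assert (HNR : 0 < INR (grid n)) by apply lt_0_INR, grid_pos.
  assert (HNi : 0 < / INR (grid n)) by now apply Rinv_0_lt_compat.
  assert (Hmesh : / INR (grid n) < th).
  { apply Rle_lt_trans with (2 := Hn0). apply Rinv_le_contravar; [apply lt_0_INR; lia|].
    apply le_INR. unfold grid. lia. }
  (* Cells around points strictly outside the interval from [al] to [be]: with mesh below [th] their
     midpoints still enclose it, and they keep distance [th] from 0 and 1. *)
  set (ia := cell (INR (grid n) * (al / 2))). set (ib := cell (INR (grid n) * ((1 + be) / 2))).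
  pose proof (idx_spec (fun n => n) n (al / 2) ltac:(lra)) as Hia.
  pose proof (idx_spec (fun n => n) n ((1 + be) / 2) ltac:(lra)) as Hib.
  pose proof (idx_right (fun n => n) n ((1 + be) / 2) ltac:(lra)) as Hibr.
  pose proof (idx_lt (fun n => n) n ((1 + be) / 2) ltac:(lra)) as Hibn.
  pose proof (idx_le (fun n => n) n (al / 2) ((1 + be) / 2) ltac:(lra)) as Hiab.
  cbv beta in *. fold (grid n) in *. fold ia in Hia, Hiab. fold ib in Hib, Hibr, Hibn, Hiab.
  assert (Hmid : forall i, midpoint (grid n) i = INR i / INR (grid n) + / 2 * / INR (grid n))
    by (intros i; unfold midpoint; field; lra).
  pose proof (midpoint_open (fun n => n) n ia ltac:(cbv beta; fold (grid n); lia)) as Hma.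
  pose proof (midpoint_open (fun n => n) n ib ltac:(cbv beta; fold (grid n); lia)) as Hmb.
  cbv beta in Hma, Hmb. fold (grid n) in Hma, Hmb.
  assert (HAa : A (midpoint (grid n) ia) <= A al).
  { apply (primitive_le h h_cont h_nonneg); [lra | rewrite Hmid; lra | lra]. }
  assert (HAb : A be <= A (midpoint (grid n) ib)).
  { apply (primitive_le h h_cont h_nonneg); [lra | rewrite Hmid; lra | lra]. }
  assert (H : th * glo (lam * D * (A (midpoint (grid n) ib) - A (midpoint (grid n) ia)) / 2)
              <= u k).
  { apply (height_lower_bound glo ghi C Hg (grid n) (grid_pos n) fe fe_nonneg lam Hlam0
      (fun i => A (midpoint (grid n) i)) _ u w k ia ib th D (grid_admissible n) Hrun); auto;
      try lra.
    - rewrite S_INR. replace ((INR ia + 1) / INR (grid n))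
        with (INR ia / INR (grid n) + / INR (grid n)) by (field; lra). lra.
    - rewrite Hum. intros s Hs1 Hs2. apply HsD. split; [|exact Hs2].
      apply Rmult_le_reg_r with (1 + C); [lra|].
      replace (th * m / (1 + C) * (1 + C)) with (th * m) by (field; lra). lra. }
  rewrite Hum in H.
  assert (Hx0l : x0 <= lam * D * (A (midpoint (grid n) ib) - A (midpoint (grid n) ia)) / 2).
  { assert (Hl2 : 2 * x0 < lam * (D * dA)).
    { apply Rmult_lt_reg_r with (/ (D * dA)); [now apply Rinv_0_lt_compat|].
      replace (lam * (D * dA) * / (D * dA)) with lam by (field; lra). exact Hlam. }
    assert (lam * D * dA <= lam * D * (A (midpoint (grid n) ib) - A (midpoint (grid n) ia))).
    { apply Rmult_le_compat_l; [apply Rmult_le_pos; lra | unfold dA; lra]. }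
    lra. }
  apply (glo_le glo ghi C Hg) in Hx0l.
  assert (Hth2 : th * ((m + 1) / th) = m + 1) by (field; lra).
  assert (th * ((m + 1) / th) <= th * glo (lam * D *
    (A (midpoint (grid n) ib) - A (midpoint (grid n) ia)) / 2)).
  { apply Rmult_le_compat_l; lra. }
  lra.
Qed.

(** The place of the discrete maximum may vary with the mesh, so the lower height bound is
    transferred to the fixed point [1/2] by the cone estimate with [theta = 1/4]; this produces the
    factor [4 * (1 + C)]. *)
Lemma solution_of_discrete (lam mlo mhi C : R) (n0 : nat) : 0 < lam -> 0 < mlo ->
  gauges glo ghi C ->
  (forall n, (n0 <= n)%nat -> exists u w k,
     discrete_solution (grid n) fe lam (fun i => A (midpoint (grid n) i))
       (fun i => G (midpoint (grid n) i)) u w k /\ mlo <= u k <= mhi) ->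
  exists v, is_positive_solution phi c d h f lam v /\
    (forall t, 0 <= t <= 1 -> 0 <= v t <= mhi) /\ mlo <= 4 * (1 + C) * v (1/2).
Proof.
  intros Hlam Hmlo Hg Hdisc. pose proof (gauge_pos _ _ _ Hg) as HC.
  destruct free_ultrafilter_exists as [U HU].
  destruct (tail_majorants_of_integrability h h_cont h_nonneg psi1 psi1_homeo h_int)
    as [KL [EL [KR [ER [B [HtL [HtR [HEL [HER [HKL [HKR HB]]]]]]]]]]].
  assert (Htail : forall Kf E Y, tail_majorant Kf E B ->
    (forall x, 0 < x <= 1/2 -> psi1 (Kf x) = Y x) ->
    forall P F, 0 <= P -> 0 <= F -> exists C1 Q, 0 <= C1 /\ 0 <= Q /\
      forall x, 0 < x <= 1/2 -> ghi (P + F * Y x) <= C1 + Q * Kf x).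
  { intros Kf E Y Ht HY P F HP HF.
    destruct (slope_hi_affine phi psi1 phi_lt phi_odd phi_psi1 pinv phi_pinv c0 d0
      c0_pos d0_pos P F HP HF) as [C1 [Q [HC1 [HQ H]]]].
    exists C1, Q. repeat split; auto. intros x Hx. rewrite <- HY by exact Hx.
    apply H. now apply (tail_pos _ _ _ Ht). }
  assert (Hseq : forall n, exists r : (nat -> R) * (nat -> R) * nat,
     discrete_solution (grid (n0 + n)) fe lam (fun i => A (midpoint (grid (n0 + n)) i))
       (fun i => G (midpoint (grid (n0 + n)) i)) (fst (fst r)) (snd (fst r)) (snd r) /\
     mlo <= fst (fst r) (snd r) <= mhi).
  { intros n. destruct (Hdisc (n0 + n)%nat ltac:(lia)) as [u [w [k Huwk]]].
    now exists (u, w, k). }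
  destruct (functional_choice _ Hseq) as [r Hr].
  destruct (limit_solution U HU glo ghi C Hg
    problem_glo_unbounded
    G (fun t _ => G_response t) (fun t w _ eps He => G_joint_continuity t w eps He)
    A h (primitive_le h h_cont h_nonneg) (primitive_deriv h h_cont)
    (primitive_continuity_pt h h_cont) h_nonneg fe fe_nonneg fe_continuity lam Hlam
    KL EL KR ER B HtL HtR (Htail KL EL _ HtL HKL) (Htail KR ER _ HtR HKR) HEL HER
    (fun n => (n0 + n)%nat) (fun n => Nat.le_add_l n n0)
    (fun n => fst (fst (r n))) (fun n => snd (fst (r n))) (fun n => snd (r n)) mlo mhi Hmlo
    (fun n => proj1 (Hr n)) (fun n => proj2 (Hr n)))
    as [us [ws [Hout [Hin [Hcone [Hleft Hright]]]]]].
  assert (Hmhi : 0 <= mhi) by (destruct (Hin (1/2) ltac:(lra)); lra).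
  assert (Hb : forall t, 0 <= us t <= mhi).
  { intros t. destruct (classic (0 < t < 1)) as [Ht|Ht]; [now apply Hin|].
    rewrite (Hout t Ht). lra. }
  assert (Huc : forall t, 0 < t < 1 -> continuity_pt us t).
  { intros t Ht. apply derivable_continuous_pt. exists (G t (ws t)). now apply Hin. }
  assert (Hwc : forall t, 0 < t < 1 -> continuity_pt ws t).
  { intros t Ht. apply derivable_continuous_pt. exists (- (lam * h t * fe (us t))). now apply Hin. }
  assert (Hu0 : us 0 = 0) by (apply Hout; lra).
  assert (Hu1 : us 1 = 0) by (apply Hout; lra).
  exists us. split; [|split].
  - split; [split|].
    + intros t Ht eps He. unfold unit_closed in *.
      destruct (Req_dec t 0) as [->|Ht0]; [|destruct (Req_dec t 1) as [->|Ht1]].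
      * destruct (Hleft (eps / 2) ltac:(lra)) as [eta [Heta H]]. exists eta.
        split; [exact Heta|]. intros s Hs Hd. rewrite Hu0, Rminus_0_r, Rabs_pos_eq by apply Hb.
        apply Rabs_def2 in Hd. destruct (classic (0 < s < 1)) as [Hs1|Hs1].
        -- specialize (H s Hs1 ltac:(lra)). lra.
        -- rewrite (Hout s Hs1). exact He.
      * destruct (Hright (eps / 2) ltac:(lra)) as [eta [Heta H]]. exists eta.
        split; [exact Heta|]. intros s Hs Hd. rewrite Hu1, Rminus_0_r, Rabs_pos_eq by apply Hb.
        apply Rabs_def2 in Hd. destruct (classic (0 < s < 1)) as [Hs1|Hs1].
        -- specialize (H s Hs1 ltac:(lra)). lra.
        -- rewrite (Hout s Hs1). exact He.
      * destruct (continuity_pt_eps us t (Huc t ltac:(lra)) eps He) as [eta [Heta H]].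
        exists eta. split; [exact Heta|]. intros s _ Hs. now apply H.
    + exists (fun t => G t (ws t)), (fun t => - (lam * h t * fe (us t))).
      split; [|now split]. intros t Ht. repeat split.
      * now apply Hin.
      * apply continuity_of_eps. intros eps He.
        destruct (G_joint_continuity t (ws t) eps He) as [e1 [He1 HG]].
        destruct (continuity_pt_eps ws t (Hwc t Ht) e1 He1) as [e2 [He2 Hws]].
        exists (Rmin e1 e2). split; [now apply Rmin_glb_lt|]. intros s Hs.
        pose proof (Rmin_l e1 e2). pose proof (Rmin_r e1 e2).
        apply HG; [lra | apply Hws; lra].
      (* Near [t] the clamps are the identity, and [d * phi (c * u')] is [ws] itself because
         [phi (pinv y) = y]. *)
      * apply is_derive_Reals. apply (is_derive_ext_loc ws).
        -- assert (Hr0 : 0 < Rmin t (1 - t)) by (apply Rmin_glb_lt; lra).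
           exists (mkposreal _ Hr0). intros s Hs.
           unfold ball, AbsRing_ball, abs, minus, plus, opp in Hs. simpl in Hs.
           unfold AbsRing_ball, abs, minus, plus, opp in Hs. simpl in Hs.
           apply Rabs_def2 in Hs. pose proof (Rmin_l t (1 - t)). pose proof (Rmin_r t (1 - t)).
           enough (Heq : ws s = d s * phi (c s * G s (ws s))) by exact Heq.
           unfold G. rewrite (clamp_id s) by (unfold unit_closed; lra).
           pose proof (c_bounds s) as Hcs. pose proof (d_bounds s) as Hds.
           rewrite (clamp_id s) in Hcs, Hds by (unfold unit_closed; lra).
           replace (c s * (pinv (ws s / d s) / c s)) with (pinv (ws s / d s)) by (field; lra).
           rewrite phi_pinv. field. lra.
        -- apply is_derive_Reals. now apply Hin.
      * apply (continuity_pt_opp (fun t => lam * h t * fe (us t))).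
        apply (continuity_pt_mult (fun t => lam * h t) (fun t => fe (us t))).
        -- apply (continuity_pt_scal h). now apply continuity_pt_interior.
        -- apply (continuity_pt_comp us fe); [now apply Huc | apply fe_continuity].
      * rewrite fe_id by apply Hb. ring.
    + intros t Ht. set (th := Rmin t (1 - t) / 2).
      assert (Hth : 0 < th /\ th < t /\ th < 1 - t).
      { unfold th. pose proof (Rmin_l t (1 - t)). pose proof (Rmin_r t (1 - t)).
        pose proof (Rmin_glb_lt t (1 - t) 0 ltac:(lra) ltac:(lra)). lra. }
      pose proof (Hcone t th ltac:(lra) ltac:(lra) ltac:(lra)).
      assert (0 < th * mlo) by (apply Rmult_lt_0_compat; lra).
      destruct (Hb t) as [[Hpos|Hz] _]; [exact Hpos|]. rewrite <- Hz in H. lra.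
  - intros t _. apply Hb.
  - pose proof (Hcone (1/2) (1/4) ltac:(lra) ltac:(lra) ltac:(lra)). lra.
Qed.

Lemma exists_small_solution (m : R) : 0 < m -> exists L, 0 < L /\ forall lam, L < lam ->
  exists v, is_positive_solution phi c d h f lam v /\ forall t, 0 <= t <= 1 -> 0 <= v t <= m.
Proof.
  intros Hm.
  destruct problem_gauges as [C Hg].
  destruct (height_avoided m Hm) as [L [HL Hav]]. exists L. split; [exact HL|].
  intros lam Hlam. assert (Hlam0 : 0 < lam) by lra.
  destruct (Hav lam Hlam) as [n0 Hn0].
  destruct (landing_bounds lam Hlam0) as [m0 [m1 [Hm0 Hland]]].
  destruct (solution_of_discrete lam m0 m C n0 Hlam0 Hm0 Hg) as [v [Hv [Hb _]]].
  - intros n Hn. apply (low_discrete_solution glo ghi C Hg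
      problem_glo_unbounded
      (grid n) (grid_pos n) fe fe_at_0 fe_continuity lam _ _ (grid_admissible n)
      (fun i _ => G_continuity _) m m0 m1 Hm Hm0 (Hland n)).
    intros u w k Hrun. now apply (Hn0 n u w k Hn).
  - now exists v.
Qed.

Lemma exists_large_solution (m : R) : 0 < m -> exists L, 0 < L /\ forall lam, L < lam ->
  exists v B, is_positive_solution phi c d h f lam v /\
    (forall t, 0 <= t <= 1 -> 0 <= v t <= B) /\ m <= v (1/2).
Proof.
  intros Hm.
  destruct problem_gauges as [C Hg]. pose proof (gauge_pos _ _ _ Hg) as HC.
  (* Compensates the factor lost when the height is read off at [1/2]. *)
  set (m' := 4 * (1 + C) * m).
  assert (Hm' : 0 < m') by (apply Rmult_lt_0_compat; lra).
  destruct (height_avoided m' Hm') as [L [HL Hav]]. exists L. split; [exact HL|].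
  intros lam Hlam. assert (Hlam0 : 0 < lam) by lra.
  destruct (Hav lam Hlam) as [n0 Hn0].
  destruct (landing_bounds lam Hlam0) as [m0 [m1 [Hm0 Hland]]].
  destruct (solution_of_discrete lam m' m1 C n0 Hlam0 Hm' Hg) as [v [Hv [Hb Hv2]]].
  - intros n Hn. apply (high_discrete_solution glo ghi C Hg
      problem_glo_unbounded
      (grid n) (grid_pos n) fe fe_at_0 fe_continuity lam _ _ (grid_admissible n)
      (fun i _ => G_continuity _) m' m0 m1 Hm' (Hland n)).
    intros u w k Hrun. now apply (Hn0 n u w k Hn).
  - exists v, m1. repeat split; auto; try apply Hv; try (now apply Hb).
    apply Rmult_le_reg_l with (4 * (1 + C)); [lra | exact Hv2].
Qed.

End Problem.

(** * Selection of nearly extremal norms and conclusion *)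

Lemma near_infimum (S : R -> Prop) (delta : R) : 0 < delta -> (exists n, S n) ->
  (forall n, S n -> 0 < n) -> exists n, S n /\ forall n', S n' -> n < n' + delta.
Proof.
  intros Hd [x Hx] Hpos.
  destruct (completeness (fun y => S (- y))) as [l [Hl1 Hl2]].
  - exists 0. intros y Hy. specialize (Hpos _ Hy). lra.
  - exists (- x). now rewrite Ropp_involutive.
  - apply NNPP. intros Hn. assert (l <= l - delta); [|lra].
    apply Hl2. intros y Hy. apply Rnot_lt_le. intros Hlt. apply Hn.
    exists (- y). split; [exact Hy|]. intros n' Hn'.
    assert (- n' <= l) by (apply Hl1; now rewrite Ropp_involutive). lra.
Qed.

(** No bound on [S] is assumed: an element beyond the cutoff [T] is accepted in place of a nearly
    maximal one. *)
Lemma near_supremum (S : R -> Prop) (T : R) : (exists n, S n) ->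
  exists n, S n /\ forall n', S n' -> n' < n + 1 \/ T <= n.
Proof.
  intros [x Hx]. destruct (classic (exists n, S n /\ T <= n)) as [[n [Hn HT]]|HT].
  - exists n. auto.
  - destruct (completeness S) as [l [Hl1 Hl2]].
    + exists T. intros y Hy. apply Rnot_lt_le. intros Hlt. apply HT. exists y. split; [auto | lra].
    + now exists x.
    + apply NNPP. intros Hn. assert (l <= l - 1); [|lra].
      apply Hl2. intros y Hy. apply Rnot_lt_le. intros Hlt. apply Hn.
      exists y. split; [exact Hy|]. intros n' Hn'. specialize (Hl1 _ Hn'). left. lra.
Qed.

Lemma sup_norm_exists (v : R -> R) (B : R) : (forall t, 0 <= t <= 1 -> 0 <= v t <= B) ->
  exists n, sup_norm_is v n /\ n <= B /\ v (1/2) <= n.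
Proof.
  intros Hv. unfold sup_norm_is.
  destruct (completeness (fun y => exists t, 0 <= t <= 1 /\ y = Rabs (v t))) as [n Hn].
  - exists B. intros y [t [Ht ->]]. rewrite Rabs_pos_eq; now apply Hv.
  - exists (Rabs (v 0)), 0. split; [lra | reflexivity].
  - exists n. split; [exact Hn|]. destruct Hn as [H1 H2]. split.
    + apply H2. intros y [t [Ht ->]]. rewrite Rabs_pos_eq; now apply Hv.
    + apply H1. exists (1/2). split; [lra|]. symmetry. apply Rabs_pos_eq, Hv. lra.
Qed.

Theorem theorem3p7
  (phi psi1 psi2 c d f h : R -> R)
  (Hphi : odd_incr_homeo phi)
  (Hpsi1 : incr_homeo_nonneg psi1)
  (Hpsi2 : incr_homeo_nonneg psi2)
  (HA : condA phi psi1 psi2)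
  (Hc : cont_on unit_closed c /\ forall t, 0 <= t <= 1 -> 0 < c t)
  (Hd : cont_on unit_closed d /\ forall t, 0 <= t <= 1 -> 0 < d t)
  (Hf : cont_on nonneg_half_line f /\ (forall s, 0 <= s -> 0 <= f s) /\
        (forall s, 0 < s -> 0 < f s))
  (Hh : cont_on unit_open h /\ (forall t, 0 < t < 1 -> 0 <= h t) /\
        (exists t, 0 < t < 1 /\ h t <> 0))
  (Hhint : h_integrability psi1 h)
  (Hgamma : exists a b abar bbar,
      is_alpha_h h a /\ is_beta_h h b /\
      is_alphabar_h h a abar /\ is_betabar_h h b bbar /\
      0 <= a /\ a < (3 * a + abar) / 4 /\
      (3 * a + abar) / 4 < (bbar + 3 * b) / 4 /\
      (bbar + 3 * b) / 4 < b /\ b <= 1)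
  (Hf0 : forall eps, 0 < eps -> exists delta, 0 < delta /\
      forall s, 0 < s < delta -> Rabs (f s / phi s) < eps)
  (Hfinf : forall eps, 0 < eps -> exists M, forall s, M < s ->
      Rabs (f s / phi s) < eps) :
  exists lam_s m_s : R, 0 < lam_s /\ 0 < m_s /\
    (exists u1 u2 : R -> R -> R, exists n1 n2 : R -> R,
       (forall lam, lam_s < lam ->
          is_positive_solution phi c d h f lam (u1 lam) /\
          is_positive_solution phi c d h f lam (u2 lam) /\
          sup_norm_is (u1 lam) (n1 lam) /\ sup_norm_is (u2 lam) (n2 lam) /\
          0 < n1 lam /\ n1 lam < m_s /\ m_s < n2 lam) /\
       (forall eps, 0 < eps -> exists L, forall lam, L < lam -> lam_s < lam ->
          n1 lam < eps) /\
       (forall M, exists L, forall lam, L < lam -> lam_s < lam -> M < n2 lam)) /\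
    (exists u, is_positive_solution phi c d h f lam_s u).
Proof.
  destruct Hphi as [_ [Hlt [Hsurj Hodd]]].
  destruct Hc as [Hcc Hcp]. destruct Hd as [Hdc Hdp].
  destruct Hf as [Hfc [Hfn Hfp]]. destruct Hh as [Hhc [Hhn Hhz]].
  destruct (functional_choice _ Hsurj) as [pinv Hpinv].
  destruct (positive_bounds c Hcc Hcp) as [c0 [c1 [Hc0 Hcb]]].
  destruct (positive_bounds d Hdc Hdp) as [d0 [d1 [Hd0 Hdb]]].
  assert (HA1 : forall x y, 0 <= x -> 0 <= y -> phi x * psi1 y <= phi (x * y))
    by (intros x y Hx Hy; now apply HA).
  pose proof (exists_small_solution phi psi1 c d f h Hlt Hodd Hpsi1 HA1 pinv Hpinv Hcc Hdc
    c0 c1 d0 d1 Hc0 Hd0 Hcb Hdb Hfc Hfn Hfp Hhc Hhn Hhz Hhint Hf0 Hfinf) as Hsmall.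
  pose proof (exists_large_solution phi psi1 c d f h Hlt Hodd Hpsi1 HA1 pinv Hpinv Hcc Hdc
    c0 c1 d0 d1 Hc0 Hd0 Hcb Hdb Hfc Hfn Hfp Hhc Hhn Hhz Hhint Hf0 Hfinf) as Hlarge.
  clear - Hsmall Hlarge.
  set (sol := fun lam v n => is_positive_solution phi c d h f lam v /\ sup_norm_is v n).
  assert (Hs : forall m, 0 < m -> exists L, 0 < L /\ forall lam, L < lam ->
            exists v n, sol lam v n /\ 0 < n <= m).
  { intros m Hm. destruct (Hsmall m Hm) as [L [HL H]]. exists L. split; [exact HL|].
    intros lam Hlam. destruct (H lam Hlam) as [v [Hv Hb]].
    destruct (sup_norm_exists v m Hb) as [n [Hn [Hnm Hvn]]]. exists v, n.
    pose proof (proj2 Hv (1/2) ltac:(lra)). split; [split; assumption | lra]. }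
  assert (Hl : forall m, 0 < m -> exists L, 0 < L /\ forall lam, L < lam ->
            exists v n, sol lam v n /\ m <= n).
  { intros m Hm. destruct (Hlarge m Hm) as [L [HL H]]. exists L. split; [exact HL|].
    intros lam Hlam. destruct (H lam Hlam) as [v [B [Hv [Hb Hv2]]]].
    destruct (sup_norm_exists v B Hb) as [n [Hn [Hnm Hvn]]]. exists v, n.
    split; [split; assumption | lra]. }
  clear Hsmall Hlarge.
  destruct (Hs (1/2) ltac:(lra)) as [L1 [HL1 H1]]. destruct (Hl 2 ltac:(lra)) as [L2 [HL2 H2]].
  (* Both thresholds are positive, so [lam_s] exceeds each strictly and the small solution exists at
     [lam_s] as well. The levels [1/2] and [2] leave room for [m_s = 1]. *)
  set (lam_s := L1 + L2).
  (* The solution must be fixed before [eps] is given. A norm within [/ lam] of the infimum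
     eventually competes with the small solutions of every level [m]. *)
  assert (Hc1 : forall lam, exists p : (R -> R) * R, lam_s < lam ->
    sol lam (fst p) (snd p) /\ 0 < snd p < 1 /\
    forall v n, sol lam v n -> 0 < n < 1 -> snd p < n + / lam).
  { intros lam. destruct (Rlt_dec lam_s lam) as [Hlam|Hlam].
    - assert (HL : L1 < lam) by (unfold lam_s in *; lra).
      destruct (H1 lam HL) as [v [n [Hv Hn]]].
      destruct (near_infimum (fun n => exists v, sol lam v n /\ 0 < n < 1) (/ lam))
        as [n0 [[v0 [Hv0 Hn0]] Hmin]].
      + apply Rinv_0_lt_compat. lra.
      + exists n, v. split; [exact Hv | lra].
      + intros n' [_ [_ Hn']]. lra.
      + exists (v0, n0). intros _. simpl. split; [exact Hv0|]. split; [lra|].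
        intros v' n' Hv' Hn'. apply Hmin. now exists v'.
    - exists (fun _ => 0, 0). intros; contradiction. }
  (* Likewise from above with cutoff [lam], which itself tends to infinity. *)
  assert (Hc2 : forall lam, exists p : (R -> R) * R, lam_s < lam ->
    sol lam (fst p) (snd p) /\ 1 < snd p /\
    forall v n, sol lam v n -> 1 < n -> n < snd p + 1 \/ lam <= snd p).
  { intros lam. destruct (Rlt_dec lam_s lam) as [Hlam|Hlam].
    - assert (HL : L2 < lam) by (unfold lam_s in *; lra).
      destruct (H2 lam HL) as [v [n [Hv Hn]]].
      destruct (near_supremum (fun n => exists v, sol lam v n /\ 1 < n) lam)
        as [n0 [[v0 [Hv0 Hn0]] Hmax]].
      + exists n, v. split; [exact Hv | lra].
      + exists (v0, n0). intros _. simpl. split; [exact Hv0|]. split; [lra|].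
        intros v' n' Hv' Hn'. apply Hmax. now exists v'.
    - exists (fun _ => 0, 0). intros; contradiction. }
  destruct (functional_choice _ Hc1) as [p1 Hp1]. destruct (functional_choice _ Hc2) as [p2 Hp2].
  exists lam_s, 1. split; [unfold lam_s; lra|]. split; [lra|]. split.
  - exists (fun lam => fst (p1 lam)), (fun lam => fst (p2 lam)),
      (fun lam => snd (p1 lam)), (fun lam => snd (p2 lam)). split; [|split].
    + intros lam Hlam. destruct (Hp1 lam Hlam) as [[Hv1 Hn1] [Hlt1 _]].
      destruct (Hp2 lam Hlam) as [[Hv2 Hn2] [Hlt2 _]].
      repeat (split; [assumption|]). lra.
    + intros eps He. set (e := Rmin (1/2) (eps / 2)).
      assert (Hepos : 0 < e) by (apply Rmin_glb_lt; lra).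
      assert (He2 : e <= 1/2 /\ e <= eps / 2) by (split; [apply Rmin_l | apply Rmin_r]).
      (* Beyond [2 / eps] the tolerance [/ lam] is below [eps / 2], and the competitor has norm at
         most [e <= eps / 2]. *)
      destruct (Hs e Hepos) as [L [HL H]]. exists (L + 2 / eps). intros lam Hlam Hlam'.
      assert (0 < 2 / eps) by (apply Rdiv_lt_0_compat; lra).
      destruct (H lam ltac:(lra)) as [v [n [Hv Hn]]].
      destruct (Hp1 lam Hlam') as [_ [_ Hmin]]. specialize (Hmin v n Hv ltac:(lra)).
      assert (/ lam < eps / 2).
      { replace (eps / 2) with (/ (2 / eps)) by (field; lra).
        apply Rinv_lt_contravar; [apply Rmult_lt_0_compat|]; lra. }
      lra.
    (* Either the selected norm exceeds [m - 1], or it is at least [lam > m]; the 2 covers the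
       tolerance 1 and keeps the competitor above 1. *)
    + intros M. set (m := Rmax M 0 + 2).
      assert (Hm : M + 2 <= m /\ 2 <= m)
        by (unfold m; pose proof (Rmax_l M 0); pose proof (Rmax_r M 0); lra).
      destruct (Hl m ltac:(lra)) as [L [HL H]]. exists (L + m). intros lam Hlam Hlam'.
      destruct (H lam ltac:(lra)) as [v [n [Hv Hn]]].
      destruct (Hp2 lam Hlam') as [_ [_ Hmax]].
      destruct (Hmax v n Hv ltac:(lra)); lra.
  - destruct (H1 lam_s ltac:(unfold lam_s; lra)) as [v [n [Hv _]]]. exists v. apply Hv.
Qed.
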